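(* Let $r\ge3$ be odd, $\zeta=e^{2\pi i/r}$, and let $\rho_1^{\mathfrak u_\zeta}(\tau_\alpha):\mathrm{ad}\to\mathrm{ad}$ be the linear map $x\mapsto v^{-1}x$ giving the quantum action of the Dehn twist $\tau_\alpha$, where $v$ is the ribbon element of $\mathfrak u_\zeta$. For all integers $0\le\ell,m,n\le r-1$, $$\rho_1^{\mathfrak u_\zeta}(\tau_\alpha)\left(E^\ell T_mF^{(n)}\right)=\zeta^{2(m+1)m}\sum_{i=0}^{r-1}\begin{bmatrix} n+i \\ n \end{bmatrix}_\zeta\zeta^{\frac{(i+3)i}2+2mi}E^{\ell+i}T_{m+i}F^{(n+i)}.$$
   Context: $\mathfrak u_\zeta$ is the $\mathbb C$-algebra with generators $E,F^{(1)},K$ and relations $E^r=(F^{(1)})^r=0$, $K^r=1$, $KEK^{-1}=\zeta^2E$, $KF^{(1)}K^{-1}=\zeta^{-2}F^{(1)}$, $[E,F^{(1)}]=K-K^{-1}$, with $\Delta(E)=E\otimes K+1\otimes E$, $\Delta(F^{(1)})=K^{-1}\otimes F^{(1)}+F^{(1)}\otimes1$, $\Delta(K)=K\otimes K$, $S(E)=-EK^{-1}$, $S(F^{(1)})=-KF^{(1)}$, $S(K)=K^{-1}$. $[n]_\zeta=\frac{\zeta^n-\zeta^{-n}}{\zeta-\zeta^{-1}}$; quantum binomials $\begin{bmatrix}k\\\ell\end{bmatrix}_q=\frac{[k]_q!}{[\ell]_q![k-\ell]_q!}\in\mathbb Z[q^{\pm1}]$ are evaluated at $q=\zeta$. $F^{(a)}=(F^{(1)})^a/[a]_\zeta!$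 for $0\le a\le r-1$ and $F^{(a)}=0$ for $a\ge r$; $T_a=\frac1r\sum_{b=0}^{r-1}\zeta^{2ab}K^b$ (index mod $r$). $\mathrm{ad}$ has underlying vector space $\mathfrak u_\zeta$. R-matrix $R=R'_i\otimes R''_i=\sum_{a,b=0}^{r-1}\zeta^{a(a-1)/2}K^{-b}E^a\otimes T_bF^{(a)}$ (sum hidden), $u=S(R''_i)R'_i$, $v=uK^{-1}$ (central, invertible). *)

(* Defs.v *)
From HB Require Import structures.
From mathcomp Require Import all_boot all_order all_algebra.
From mathcomp Require Import complex.
From mathcomp Require Import all_classical all_reals all_analysis.

Set Implicit Arguments.
Unset Strict Implicit.
Unset Printing Implicit Defensive.

Import Order.TTheory GRing.Theory Num.Theory.
Local Open Scope ring_scope.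
Local Open Scope quotient_scope.

Definition zeta (R : realType) (r : nat) : R[i] :=
  (cos (2 * pi / r%:R) +i* sin (2 * pi / r%:R))%C.

Definition qint (F : fieldType) (q : F) (n : nat) : F :=
  (q ^+ n - q ^- n) / (q - q^-1).

Definition qfact (F : fieldType) (q : F) (n : nat) : F :=
  \prod_(1 <= k < n.+1) qint q k.

Definition qvar : {fraction {poly int}} := tofrac 'X.

Definition qbinom (k l : nat) : {fraction {poly int}} :=
  qfact qvar k / (qfact qvar l * qfact qvar (k - l)).

(* An element of Z[q^{+-1}] has the form p(q) / q^N with p in Z[q]; its value
   at z is p(z) / z^N.  The value is 0 by convention outside Z[q^{+-1}]. *)
Definition laurent_value (F : fieldType) (z : F) (f : {fraction {poly int}})
    : F :=
  xget 0 [set c : F | exists (N : nat) (p : {poly int}),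
    f * qvar ^+ N = tofrac p /\ c = (map_poly intr p).[z] / z ^+ N]%classic.

Definition qbinom_at (F : fieldType) (z : F) (k l : nat) : F :=
  laurent_value z (qbinom k l).

Inductive ugen := GE | GF | GK.

(* Noncommutative polynomial expressions in the generators; modulo the axioms
   of associative unital C-algebras they form the free algebra C<E, F, K>. *)
Inductive uterm (C : Type) :=
  | Gen of ugen
  | Cst of C
  | Add of uterm C & uterm C
  | Mul of uterm C & uterm C.

Section Presentation.
Variables (C : fieldType) (z : C) (r : nat).

Local Notation term := (uterm C).
Local Notation tE := (@Gen C GE).
Local Notation tF := (@Gen C GF).
Local Notation tK := (@Gen C GK).

Definition Exp (x : term) (n : nat) : term := iter n (Mul x) (Cst 1).
Definition Opp (x : term) : term := Mul (Cst (-1)) x.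

(* Inverse of K, since K^r = 1. *)
Definition Kinv : term := Exp tK r.-1.

Inductive urel : term -> term -> Prop :=
  | rel_E : urel (Exp tE r) (Cst 0)
  | rel_F : urel (Exp tF r) (Cst 0)
  | rel_K : urel (Exp tK r) (Cst 1)
  | rel_KE : urel (Mul (Mul tK tE) Kinv) (Mul (Cst (z ^+ 2)) tE)
  | rel_KF : urel (Mul (Mul tK tF) Kinv) (Mul (Cst (z ^- 2)) tF)
  | rel_EF : urel (Add (Mul tE tF) (Opp (Mul tF tE))) (Add tK (Opp Kinv)).

(* Least C-algebra congruence containing the relations.  The guard 0 < r is
   there because E^0 = 0 would make the algebra trivial, hence not a nzRing. *)
Inductive ucong : term -> term -> Prop :=
  | ucong_rel x y : (0 < r)%N -> urel x y -> ucong x y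
  | ucong_refl x : ucong x x
  | ucong_sym x y : ucong x y -> ucong y x
  | ucong_trans x y t : ucong x y -> ucong y t -> ucong x t
  | ucong_add x x' y y' : ucong x x' -> ucong y y' ->
      ucong (Add x y) (Add x' y')
  | ucong_mul x x' y y' : ucong x x' -> ucong y y' ->
      ucong (Mul x y) (Mul x' y')
  | ucong_addA x y t : ucong (Add x (Add y t)) (Add (Add x y) t)
  | ucong_addC x y : ucong (Add x y) (Add y x)
  | ucong_add0 x : ucong (Add (Cst 0) x) x
  | ucong_addN x : ucong (Add (Opp x) x) (Cst 0)
  | ucong_mulA x y t : ucong (Mul x (Mul y t)) (Mul (Mul x y) t)
  | ucong_1mul x : ucong (Mul (Cst 1) x) x
  | ucong_mul1 x : ucong (Mul x (Cst 1)) x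
  | ucong_mulDl x y t : ucong (Mul (Add x y) t) (Add (Mul x t) (Mul y t))
  | ucong_mulDr x y t : ucong (Mul t (Add x y)) (Add (Mul t x) (Mul t y))
  | ucong_cstD a b : ucong (Cst (a + b)) (Add (Cst a) (Cst b))
  | ucong_cstM a b : ucong (Cst (a * b)) (Mul (Cst a) (Cst b))
  | ucong_cstC a x : ucong (Mul (Cst a) x) (Mul x (Cst a)).

HB.instance Definition _ := gen_eqMixin term.
HB.instance Definition _ := gen_choiceMixin term.

Definition ucongb (x y : term) : bool := `[< ucong x y >].

Lemma ucongb_equiv : equiv_class_of ucongb.
Proof.
split=> [x|x y|y x t].
- exact/asboolP/ucong_refl.
- by apply/asboolP/asboolP; apply: ucong_sym.
- by move=> /asboolP h1 /asboolP h2; apply/asboolP/(ucong_trans h1 h2).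
Qed.

Canonical ucongb_canonical := EquivRelPack ucongb_equiv.

Definition uz := {eq_quot ucongb}.

HB.instance Definition _ := Choice.on uz.
HB.instance Definition _ := EqQuotient.on uz.

Lemma pi_ucong (x y : term) : ucong x y <-> \pi_uz x = \pi_uz y.
Proof. by split=> [h|/eqmodP/asboolP]; first exact/eqmodP/asboolP. Qed.

Lemma ucong_repr (x : term) : ucong (repr (\pi_uz x)) x.
Proof. by apply/pi_ucong; rewrite reprK. Qed.

Definition uz_cst (c : C) : uz := \pi_uz (Cst c).
Definition uz_add (x y : uz) : uz := \pi_uz (Add (repr x) (repr y)).
Definition uz_opp (x : uz) : uz := \pi_uz (Opp (repr x)).
Definition uz_mul (x y : uz) : uz := \pi_uz (Mul (repr x) (repr y)).
Definition uz_scale (c : C) (x : uz) : uz := \pi_uz (Mul (Cst c) (repr x)).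

Lemma uz_add_pi x y : uz_add (\pi_uz x) (\pi_uz y) = \pi_uz (Add x y).
Proof. by apply/pi_ucong; apply: ucong_add; apply: ucong_repr. Qed.
Lemma uz_mul_pi x y : uz_mul (\pi_uz x) (\pi_uz y) = \pi_uz (Mul x y).
Proof. by apply/pi_ucong; apply: ucong_mul; apply: ucong_repr. Qed.
Lemma uz_opp_pi x : uz_opp (\pi_uz x) = \pi_uz (Opp x).
Proof.
by apply/pi_ucong; apply: ucong_mul; [exact: ucong_refl | exact: ucong_repr].
Qed.
Lemma uz_scale_pi c x : uz_scale c (\pi_uz x) = \pi_uz (Mul (Cst c) x).
Proof.
by apply/pi_ucong; apply: ucong_mul; [exact: ucong_refl | exact: ucong_repr].
Qed.

Definition uz_pi := (uz_opp_pi, uz_add_pi, uz_mul_pi).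

Lemma uz_addA : associative uz_add.
Proof.
elim/quotW=> x; elim/quotW=> y; elim/quotW=> t.
by have /pi_ucong := ucong_addA x y t; rewrite -!uz_pi.
Qed.
Lemma uz_addC : commutative uz_add.
Proof.
elim/quotW=> x; elim/quotW=> y.
by have /pi_ucong := ucong_addC x y; rewrite -!uz_pi.
Qed.
Lemma uz_add0 : left_id (uz_cst 0) uz_add.
Proof. by elim/quotW=> x; have /pi_ucong := ucong_add0 x; rewrite -!uz_pi. Qed.
Lemma uz_addN : left_inverse (uz_cst 0) uz_opp uz_add.
Proof. by elim/quotW=> x; have /pi_ucong := ucong_addN x; rewrite -!uz_pi. Qed.

HB.instance Definition _ :=
  GRing.isZmodule.Build uz uz_addA uz_addC uz_add0 uz_addN.

Section Evaluation.
Variables (A : algType C) (e f k : A).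

Fixpoint ueval (x : term) : A :=
  match x with
  | Gen GE => e
  | Gen GF => f
  | Gen GK => k
  | Cst c => c%:A
  | Add x y => ueval x + ueval y
  | Mul x y => ueval x * ueval y
  end.

Lemma ueval_exp x n : ueval (Exp x n) = ueval x ^+ n.
Proof. by elim: n => [|n IHn] /=; rewrite ?scale1r // exprS IHn. Qed.

Lemma ueval_opp x : ueval (Opp x) = - ueval x.
Proof. by rewrite /= mulr_algl scaleN1r. Qed.

Hypothesis eval_rel : (0 < r)%N ->
  [/\ e ^+ r = 0, f ^+ r = 0 & k ^+ r = 1] /\
  [/\ k * e * k ^+ r.-1 = z ^+ 2 *: e,
      k * f * k ^+ r.-1 = z ^- 2 *: f
    & e * f - f * e = k - k ^+ r.-1].

Lemma ueval_cong x y : ucong x y -> ueval x = ueval y.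
Proof.
elim=> {x y} /=.
- move=> x y r0; have [[he hf hk] [hke hkf hef]] := eval_rel r0.
  by case=> /=; rewrite ?mulr_algl ?ueval_exp /= ?scale0r ?scale1r ?scaleN1r.
- by [].
- by [].
- by move=> x y t _ -> _ ->.
- by move=> x x' y y' _ -> _ ->.
- by move=> x x' y y' _ -> _ ->.
- by move=> x y t; rewrite addrA.
- by move=> x y; rewrite addrC.
- by move=> x; rewrite scale0r add0r.
- by move=> x; rewrite mulr_algl scaleN1r addNr scale0r.
- by move=> x y t; rewrite mulrA.
- by move=> x; rewrite scale1r mul1r.
- by move=> x; rewrite scale1r mulr1.
- by move=> x y t; rewrite mulrDl.
- by move=> x y t; rewrite mulrDr.
- by move=> a b; rewrite scalerDl.
- by move=> a b; rewrite mulr_algl scalerA.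
- by move=> a x; rewrite mulr_algl mulr_algr.
Qed.

End Evaluation.

Lemma uz_mulA : associative uz_mul.
Proof.
elim/quotW=> x; elim/quotW=> y; elim/quotW=> t.
by have /pi_ucong := ucong_mulA x y t; rewrite -!uz_pi.
Qed.
Lemma uz_mul1l : left_id (uz_cst 1) uz_mul.
Proof. by elim/quotW=> x; have /pi_ucong := ucong_1mul x; rewrite -!uz_mul_pi. Qed.
Lemma uz_mul1r : right_id (uz_cst 1) uz_mul.
Proof. by elim/quotW=> x; have /pi_ucong := ucong_mul1 x; rewrite -!uz_mul_pi. Qed.
Lemma uz_mulDl : left_distributive uz_mul +%R.
Proof.
elim/quotW=> x; elim/quotW=> y; elim/quotW=> t.
by have /pi_ucong := ucong_mulDl x y t; rewrite -!(uz_add_pi, uz_mul_pi).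
Qed.
Lemma uz_mulDr : right_distributive uz_mul +%R.
Proof.
elim/quotW=> t; elim/quotW=> x; elim/quotW=> y.
by have /pi_ucong := ucong_mulDr x y t; rewrite -!(uz_add_pi, uz_mul_pi).
Qed.
Lemma uz_1neq0 : uz_cst 1 != 0.
Proof.
apply/eqP => /pi_ucong /(@ueval_cong C^o 0 0 1).
rewrite /= !scale1r !scale0r => h.
have: (1 : C^o) = 0.
  apply: h => r0; rewrite !expr1n !expr0n !mulr0 !mul0r !scaler0 !subrr.
  by case: r r0.
by move/eqP; rewrite oner_eq0.
Qed.

HB.instance Definition _ := GRing.Zmodule_isNzRing.Build uz
  uz_mulA uz_mul1l uz_mul1r uz_mulDl uz_mulDr uz_1neq0.

Lemma uz_scaleA a b (x : uz) : uz_scale a (uz_scale b x) = uz_scale (a * b) x.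
Proof.
elim/quotW: x => x; rewrite (uz_scale_pi b) !uz_scale_pi; apply/pi_ucong.
apply: ucong_trans (ucong_mulA _ _ _) _.
apply: ucong_mul (ucong_refl _); exact/ucong_sym/ucong_cstM.
Qed.
Lemma uz_scale1 : left_id 1 uz_scale.
Proof. by elim/quotW=> x; rewrite uz_scale_pi; apply/pi_ucong; apply: ucong_1mul. Qed.
Lemma uz_scaleDr : right_distributive uz_scale +%R.
Proof.
move=> a; elim/quotW=> x; elim/quotW=> y.
by have /pi_ucong := ucong_mulDr x y (Cst a); rewrite -!(uz_add_pi, uz_scale_pi).
Qed.
Lemma uz_scaleDl (x : uz) : {morph uz_scale^~ x : a b / a + b}.
Proof.
elim/quotW: x => x a b.
have /pi_ucong : ucong (Mul (Cst (a + b)) x) (Add (Mul (Cst a) x) (Mul (Cst b) x)).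
  apply: ucong_trans (ucong_mulDl _ _ _).
  exact: ucong_mul (ucong_cstD _ _) (ucong_refl _).
by rewrite -!(uz_add_pi, uz_scale_pi).
Qed.

HB.instance Definition _ := GRing.Zmodule_isLmodule.Build C uz
  uz_scaleA uz_scale1 uz_scaleDr uz_scaleDl.

Lemma uz_scaleAl (a : C) (x y : uz) : a *: (x * y) = (a *: x) * y.
Proof.
elim/quotW: x => x; elim/quotW: y => y.
by have /pi_ucong := ucong_mulA (Cst a) x y; rewrite -!(uz_scale_pi, uz_mul_pi).
Qed.

HB.instance Definition _ := GRing.Lmodule_isLalgebra.Build C uz uz_scaleAl.

Lemma uz_scaleAr (a : C) (x y : uz) : a *: (x * y) = x * (a *: y).
Proof.
elim/quotW: x => x; elim/quotW: y => y.
have /pi_ucong : ucong (Mul (Cst a) (Mul x y)) (Mul x (Mul (Cst a) y)).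
  apply: ucong_trans (ucong_mulA _ _ _) _.
  apply: ucong_trans (ucong_sym (ucong_mulA _ _ _)).
  exact: ucong_mul (ucong_cstC _ _) (ucong_refl _).
by rewrite -!(uz_scale_pi, uz_mul_pi).
Qed.

HB.instance Definition _ := GRing.Lalgebra_isAlgebra.Build C uz uz_scaleAr.

Definition uz_unit : pred uz :=
  fun x => `[< exists y : uz, y * x = 1 /\ x * y = 1 >].
Definition uz_inv (x : uz) : uz :=
  xget x [set y : uz | y * x = 1 /\ x * y = 1]%classic.

Lemma uz_invP x : uz_unit x -> uz_inv x * x = 1 /\ x * uz_inv x = 1.
Proof. by move/asboolP=> [y hy]; rewrite /uz_inv; case: xgetP => [t _|/(_ y)]. Qed.
Lemma uz_mulVr : {in uz_unit, left_inverse 1 uz_inv *%R}.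
Proof. by move=> x /uz_invP[]. Qed.
Lemma uz_mulrV : {in uz_unit, right_inverse 1 uz_inv *%R}.
Proof. by move=> x /uz_invP[]. Qed.
Lemma uz_unitP (x y : uz) : y * x = 1 /\ x * y = 1 -> x \in uz_unit.
Proof. by move=> h; apply/asboolP; exists y. Qed.
Lemma uz_inv_out : {in [predC uz_unit], uz_inv =1 id}.
Proof.
move=> x /negP hx; rewrite /uz_inv; case: xgetP => // y _ hy.
by case: hx; apply: uz_unitP hy.
Qed.

HB.instance Definition _ := GRing.NzRing_hasMulInverse.Build uz
  uz_mulVr uz_mulrV uz_unitP uz_inv_out.

Definition uE : uz := \pi_uz tE.
Definition uF : uz := \pi_uz tF.
Definition uK : uz := \pi_uz tK.

Lemma pi_add x y : \pi_uz (Add x y) = \pi_uz x + \pi_uz y.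
Proof. exact/esym/uz_add_pi. Qed.
Lemma pi_mul x y : \pi_uz (Mul x y) = \pi_uz x * \pi_uz y.
Proof. exact/esym/uz_mul_pi. Qed.
Lemma pi_opp x : \pi_uz (Opp x) = - \pi_uz x.
Proof. exact/esym/uz_opp_pi. Qed.
Lemma pi_cst c : \pi_uz (Cst c) = c%:A.
Proof.
rewrite /GRing.scale /= -[1]/(uz_cst 1) uz_scale_pi.
by apply/pi_ucong; apply: ucong_sym; apply: ucong_mul1.
Qed.
Lemma pi_exp x n : \pi_uz (Exp x n) = \pi_uz x ^+ n.
Proof. by elim: n => [|n IHn]; rewrite ?pi_cst ?scale1r // exprS -IHn pi_mul. Qed.

Definition pi_uzE := (pi_add, pi_opp, pi_mul, pi_cst, pi_exp).

Section Relations.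
Hypothesis r0 : (0 < r)%N.

Let relP x y (h : urel x y) := (pi_ucong x y).1 (ucong_rel r0 h).

Lemma uE_exp : uE ^+ r = 0.
Proof. by have := relP rel_E; rewrite !pi_uzE scale0r. Qed.
Lemma uF_exp : uF ^+ r = 0.
Proof. by have := relP rel_F; rewrite !pi_uzE scale0r. Qed.
Lemma uK_exp : uK ^+ r = 1.
Proof. by have := relP rel_K; rewrite !pi_uzE scale1r. Qed.
Lemma uK_unit : uK \is a GRing.unit.
Proof.
apply/unitrP; exists (uK ^+ r.-1).
by rewrite -exprSr -exprS prednK // uK_exp.
Qed.
Lemma uK_inv : uK^-1 = uK ^+ r.-1.
Proof. by apply: (mulrI uK_unit); rewrite divrr ?uK_unit // -exprS prednK // uK_exp. Qed.
Lemma uKE : uK * uE * uK^-1 = z ^+ 2 *: uE.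
Proof. by have := relP rel_KE; rewrite !pi_uzE mulr_algl uK_inv. Qed.
Lemma uKF : uK * uF * uK^-1 = z ^- 2 *: uF.
Proof. by have := relP rel_KF; rewrite !pi_uzE mulr_algl uK_inv. Qed.
Lemma uEF : uE * uF - uF * uE = uK - uK^-1.
Proof. by have := relP rel_EF; rewrite !pi_uzE uK_inv. Qed.

Lemma uKE_comm : uK * uE = z ^+ 2 *: (uE * uK).
Proof. by rewrite scalerAl -uKE mulrVK ?uK_unit. Qed.
Lemma uKF_comm : uK * uF = z ^- 2 *: (uF * uK).
Proof. by rewrite scalerAl -uKF mulrVK ?uK_unit. Qed.

End Relations.

(* The antipode, as the algebra antihomomorphism with the prescribed values on
   the generators. *)
Fixpoint tS (x : term) : term :=
  match x with
  | Gen GE => Opp (Mul tE Kinv)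
  | Gen GF => Opp (Mul tK tF)
  | Gen GK => Kinv
  | Cst c => Cst c
  | Add x y => Add (tS x) (tS y)
  | Mul x y => Mul (tS y) (tS x)
  end.

Lemma pi_tS_exp x n : \pi_uz (tS (Exp x n)) = \pi_uz (tS x) ^+ n.
Proof. by elim: n => [|n IHn]; rewrite ?pi_cst ?scale1r // exprSr -IHn pi_mul. Qed.

Lemma qcomm_exp (x y : uz) (c : C) n : y * x = c *: (x * y) ->
  exists d : C, (x * y) ^+ n = d *: (x ^+ n * y ^+ n).
Proof.
move=> h.
have h' m : y ^+ m * x = c ^+ m *: (x * y ^+ m).
  elim: m => [|m IHm]; first by rewrite !expr0 mulr1 mul1r scale1r.
  rewrite [in LHS]exprS -mulrA IHm -scalerAr [y * _]mulrA h.
  by rewrite -scalerAl scalerA -mulrA -exprSr -exprS.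
elim: n => [|n [d IHn]]; first by exists 1; rewrite !expr0 mulr1 scale1r.
exists (d * c ^+ n); rewrite exprSr IHn -scalerAl mulrA.
rewrite -[_ * x]mulrA h' -scalerAr -scalerAl scalerA.
by rewrite !exprSr !mulrA.
Qed.

Lemma tS_cong x y : ucong x y -> ucong (tS x) (tS y).
Proof.
elim=> {x y} /=.
- move=> x y r0 hxy; apply/pi_ucong.
  have Kr := uK_exp r0; have Ku := uK_unit r0; have Ki := uK_inv r0.
  have piKi : \pi_uz Kinv = uK^-1 by rewrite /Kinv pi_exp Ki.
  have piSE : \pi_uz (tS tE) = - (uE * uK^-1) by rewrite pi_opp pi_mul piKi.
  have piSF : \pi_uz (tS tF) = - (uK * uF) by rewrite pi_opp pi_mul.
  have piSKi : \pi_uz (tS Kinv) = uK.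
    by rewrite /Kinv pi_tS_exp /= piKi exprVn -Ki invrK.
  case: hxy.
  + rewrite pi_tS_exp piSE exprNn pi_cst scale0r.
    have hc : uK^-1 * uE = (z ^+ 2) ^+ r.-1 *: (uE * uK^-1).
      rewrite Ki; elim: r.-1 => [|m IHm].
        by rewrite !expr0 mulr1 mul1r scale1r.
      rewrite [in LHS]exprS -mulrA IHm -scalerAr [uK * _]mulrA (uKE_comm r0).
      by rewrite -scalerAl scalerA -mulrA -exprSr -exprS.
    have [d ->] := qcomm_exp r hc.
    by rewrite (uE_exp r0) mul0r scaler0 mulr0.
  + rewrite pi_tS_exp piSF exprNn pi_cst scale0r.
    have [z0|z0] := eqVneq z 0.
      have /eqP := uKF_comm r0; rewrite z0 expr0n /= invr0 scale0r => /eqP ->.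
      by rewrite expr0n gtn_eqF //= mulr0.
    have hc : uF * uK = z ^+ 2 *: (uK * uF).
      by rewrite (uKF_comm r0) scalerA mulfV ?scale1r // expf_neq0.
    have [d ->] := qcomm_exp r hc.
    by rewrite (uF_exp r0) mulr0 scaler0 mulr0.
  + by rewrite pi_tS_exp /= piKi exprVn Kr invr1 pi_cst scale1r.
  + rewrite pi_mul piSKi pi_mul piSE piKi pi_mul piSE pi_cst mulr_algr.
    by rewrite mulNr mulrN scalerN !mulrA uKE // scalerAl.
  + rewrite pi_mul piSKi pi_mul piSF piKi pi_mul piSF pi_cst mulr_algr.
    by rewrite mulNr mulrN scalerN uKF // -scalerAr.
  + have -> : tS (Add (Mul tE tF) (Opp (Mul tF tE))) =
      Add (Mul (tS tF) (tS tE)) (Mul (Mul (tS tE) (tS tF)) (Cst (-1))) by [].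
    have -> : tS (Add tK (Opp Kinv)) = Add Kinv (Mul (tS Kinv) (Cst (-1))) by [].
    rewrite (pi_add Kinv) (pi_mul (tS Kinv)) piSKi piKi pi_cst mulr_algr scaleN1r.
    rewrite pi_add (pi_mul (tS tF)) (pi_mul _ (Cst _)) (pi_mul (tS tE)) pi_cst.
    rewrite mulr_algr scaleN1r piSE piSF !mulrNN !mulrA mulrVK //.
    have -> : uK * uF * uE * uK^-1 = uF * uE.
      have [z0|z0] := eqVneq z 0.
        have /eqP := uKF_comm r0; rewrite z0 expr0n /= invr0 scale0r => /eqP h.
        by rewrite h !mul0r; apply: (mulrI Ku); rewrite mulrA h mul0r mulr0.
      rewrite (uKF_comm r0) -!scalerAl -[_ * uK * uE]mulrA (uKE_comm r0).
      rewrite -scalerAr -scalerAl scalerA mulVf ?scale1r ?expf_neq0 //.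
      by rewrite !mulrA mulrK.
    by rewrite -opprB uEF // opprB.
- by move=> x; apply: ucong_refl.
- by move=> x y _; apply: ucong_sym.
- by move=> x y t _ h1 _; apply: ucong_trans.
- by move=> x x' y y' _ h1 _ h2; apply: ucong_add.
- by move=> x x' y y' _ h1 _ h2; apply: ucong_mul.
- by move=> x y t; apply: ucong_addA.
- by move=> x y; apply: ucong_addC.
- by move=> x; apply: ucong_add0.
- move=> x; apply: ucong_trans (ucong_addN (tS x)).
  by apply: ucong_add (ucong_refl _); apply/ucong_sym/ucong_cstC.
- by move=> x y t; apply/ucong_sym/ucong_mulA.
- by move=> x; apply: ucong_mul1.
- by move=> x; apply: ucong_1mul.
- by move=> x y t; apply: ucong_mulDr.
- by move=> x y t; apply: ucong_mulDl.
- by move=> a b; apply: ucong_cstD.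
- by move=> a b; rewrite mulrC; apply: ucong_cstM.
- by move=> a x; apply/ucong_sym/ucong_cstC.
Qed.

Definition uS (x : uz) : uz := \pi_uz (tS (repr x)).

Lemma uS_pi x : uS (\pi_uz x) = \pi_uz (tS x).
Proof. apply/pi_ucong; apply: tS_cong; apply: ucong_repr. Qed.

Lemma uS_linear : linear uS.
Proof.
move=> a; elim/quotW=> x; elim/quotW=> y.
have -> : a *: \pi_uz x + \pi_uz y = \pi_uz (Add (Mul (Cst a) x) y).
  by rewrite pi_add pi_mul pi_cst mulr_algl.
rewrite (uS_pi x) (uS_pi y) (uS_pi (Add _ _)).
rewrite -[tS (Add _ _)]/(Add (Mul (tS x) (Cst a)) (tS y)).
by rewrite pi_add pi_mul pi_cst mulr_algr.
Qed.

HB.instance Definition _ := GRing.isLinear.Build C uz uz *:%R uS uS_linear.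

Lemma uS1 : uS 1 = 1.
Proof. exact: uS_pi (Cst 1). Qed.
Lemma uSM x y : uS (x * y) = uS y * uS x.
Proof.
elim/quotW: x => x; elim/quotW: y => y.
rewrite -(pi_mul x y) (uS_pi (Mul x y)) (uS_pi x) (uS_pi y).
exact: pi_mul (tS y) (tS x).
Qed.
Lemma uS_E : (0 < r)%N -> uS uE = - (uE * uK^-1).
Proof. by move=> r0; rewrite (uS_pi tE) (pi_opp (Mul _ _)) (pi_mul tE) pi_exp (uK_inv r0). Qed.
Lemma uS_F : uS uF = - (uK * uF).
Proof. by rewrite (uS_pi tF) (pi_opp (Mul _ _)) (pi_mul tK). Qed.
Lemma uS_K : (0 < r)%N -> uS uK = uK^-1.
Proof. by move=> r0; rewrite (uS_pi tK) (pi_exp tK) (uK_inv r0). Qed.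

Definition uFd (a : nat) : uz :=
  if (a < r)%N then (qfact z a)^-1 *: uF ^+ a else 0.

Definition uT (a : nat) : uz :=
  r%:R^-1 *: \sum_(b < r) z ^+ (2 * a * b) *: uK ^+ b.

(* The R-matrix is the sum over a, b < r of the tensors
   Rfst a b (x) Rsnd a b. *)
Definition Rfst (a b : nat) : uz :=
  z ^+ (a * (a - 1))./2 *: (uK ^- b * uE ^+ a).
Definition Rsnd (a b : nat) : uz := uT b * uFd a.

Definition drinfeld_u : uz :=
  \sum_(a < r) \sum_(b < r) uS (Rsnd a b) * Rfst a b.

Definition ribbon : uz := drinfeld_u * uK^-1.

Definition ad := uz.
HB.instance Definition _ := GRing.Lmodule.on ad.

Definition rho1_tau_alpha (x : ad) : ad := ribbon^-1 * (x : uz).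

Lemma rho1_tau_alpha_linear : linear rho1_tau_alpha.
Proof. by move=> a x y; rewrite /rho1_tau_alpha mulrDr -scalerAr. Qed.

HB.instance Definition _ :=
  GRing.isLinear.Build C ad ad *:%R rho1_tau_alpha rho1_tau_alpha_linear.

End Presentation.

(* Main.v *)
Require Import Defs.
From HB Require Import structures.
From mathcomp Require Import all_boot all_order all_algebra.
From mathcomp Require Import complex.
From mathcomp Require Import all_classical all_reals all_analysis.
From mathcomp Require Import ring lra zify.

Set Implicit Arguments.
Unset Strict Implicit.
Unset Printing Implicit Defensive.

Import Order.TTheory GRing.Theory Num.Theory.
Local Open Scope ring_scope.

(* The element
     W(c) = \sum_(m, i) c(i, m) E^i F^(i) T_m
   commutes with E as soon as the coefficients satisfy a two-term recursion
   (E_balanced).  If both W(c) and W(c') do, then in the product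
   W(c) W(c') = \sum E^i W(c) F^(i) T_m c'(i, m) the powers of E and the divided
   powers of F collect, so that W(c) W(c') = 1 becomes a family of q-binomial
   identities.  The coefficients tw of the asserted formula and their signed
   inverses itw satisfy the recursion and these identities, so W(tw) and W(itw)
   are mutually inverse.  By definition v is a combination of the F^(k) E^k T_m;
   rewriting W(itw) in these elements and summing with the Cauchy binomial
   theorem, using [k+s choose s] = (-1)^s [r-1-k choose s] at a root of unity,
   shows that v = W(itw).  Hence v^-1 = W(tw), and applying it to E^l T_m F^(n)
   only requires moving it past E^l. *)

(** * Gaussian binomials *)

Section GaussianBinomial.
Variable R : comNzRingType.
Implicit Types q Y : R.

(** Defined by the q-Pascal recursion, without division, so that it makes sense in Z[q] and at roots
    of unity alike and commutes with ring morphisms. *)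
Fixpoint gbin q n k : R :=
  match n, k with
  | _, 0 => 1
  | 0, _.+1 => 0
  | n'.+1, k'.+1 => gbin q n' k' + q ^+ k'.+1 * gbin q n' k'.+1
  end.

Lemma gbin0 q n : gbin q n 0 = 1.
Proof. by case: n. Qed.

Lemma gbinS q n k :
  gbin q n.+1 k.+1 = gbin q n k + q ^+ k.+1 * gbin q n k.+1.
Proof. by []. Qed.

Lemma gbin_small q n k : (n < k)%N -> gbin q n k = 0.
Proof.
elim: n k => [|n IHn] [|k] //= ltnk.
by rewrite !IHn ?mulr0 ?addr0 // (ltn_trans _ ltnk).
Qed.

Lemma gbin_nn q n : gbin q n n = 1.
Proof. by elim: n => //= n ->; rewrite gbin_small ?mulr0 ?addr0. Qed.

(** Pascal's rule tested against an arbitrary sequence; it reduces identities for such sums to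
    termwise identities in [a]. *)
Lemma sum_gbinS q n (a : nat -> R) :
  \sum_(s < n.+2) gbin q n.+1 s * a s =
  \sum_(s < n.+1) gbin q n s * (a s.+1 + q ^+ s * a s).
Proof.
rewrite big_ord_recl gbin0 mul1r.
under eq_bigr do rewrite lift0 gbinS mulrDl.
rewrite big_split /=; under [RHS]eq_bigr do rewrite mulrDr.
rewrite big_split /= addrCA; congr (_ + _).
rewrite big_ord_recr /= gbin_small // mulr0 mul0r addr0.
rewrite [RHS]big_ord_recl gbin0 expr0 !mul1r; congr (_ + _).
by apply: eq_bigr => s _; rewrite lift0 mulrCA mulrA.
Qed.

(** For a(s) = (-1)^s q^C(s,2), each term a(s+1) + q^s a(s) of [sum_gbinS] is zero. *)
Lemma gbin_alt_sum0 q n : (0 < n)%N ->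
  \sum_(s < n.+1) (-1) ^+ s * q ^+ 'C(s, 2) * gbin q n s = 0.
Proof.
case: n => // n _.
under eq_bigr do rewrite mulrC.
rewrite (sum_gbinS q n (fun s => (-1) ^+ s * q ^+ 'C(s, 2))) big1 // => s _.
by rewrite binS bin1 exprD exprS; ring.
Qed.

(* Cauchy's binomial theorem in Newton form. *)
Lemma gbin_newton q Y n :
  \sum_(s < n.+1) gbin q n s * \prod_(t < s) (Y - q ^+ t) = Y ^+ n.
Proof.
elim: n => [|n IHn]; first by rewrite big_ord1 big_ord0 mulr1.
rewrite (sum_gbinS q n (fun s => \prod_(t < s) (Y - q ^+ t))) exprSr -IHn.
rewrite mulr_suml; apply: eq_bigr => s _.
by rewrite big_ord_recr /=; ring.
Qed.

End GaussianBinomial.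

Lemma rmorph_gbin (R S : comNzRingType) (f : {rmorphism R -> S}) (q : R) n k :
  f (gbin q n k) = gbin (f q) n k.
Proof.
elim: n k => [|n IHn] [|k] /=; rewrite ?rmorph1 ?rmorph0 //.
by rewrite rmorphD rmorphM rmorphXn /= !IHn.
Qed.

(** * Quantum factorials and their relation to [gbin] *)

Section QuantumFactorial.
Variables (F : fieldType) (q : F).
Hypothesis q_neq0 : q != 0.

Lemma qint0 : qint q 0 = 0.
Proof. by rewrite /qint expr0 invr1 subrr mul0r. Qed.

Lemma qintD i j : qint q (i + j) = q ^- j * qint q i + q ^+ i * qint q j.
Proof.
rewrite /qint !mulrA -mulrDl; congr (_ / _); rewrite exprD invfM.
have ? := expf_neq0 i q_neq0; have ? := expf_neq0 j q_neq0.
by field; apply/andP.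
Qed.

Lemma qfact0 : qfact q 0 = 1.
Proof. by rewrite /qfact big_nil. Qed.

Lemma qfactS n : qfact q n.+1 = qfact q n * qint q n.+1.
Proof. by rewrite /qfact big_nat_recr. Qed.

Lemma qfact_neq0 n :
  (forall k, (0 < k <= n)%N -> qint q k != 0) -> qfact q n != 0.
Proof.
move=> nz; rewrite /qfact big_nat prodf_seq_neq0.
by apply/allP => k _; apply/implyP; rewrite ltnS => /nz.
Qed.

(** The symmetric quantum binomial is q^(-ij) times [gbin] at q^2; clearing denominators also covers
    vanishing factorials. The induction on i and j matches Pascal's rule with [qintD]. *)
Lemma qfactD i j :
  qfact q (i + j) * q ^+ (i * j) =
  qfact q i * qfact q j * gbin (q ^+ 2) (i + j) i.
Proof.
elim: i j => [|i IHi] j.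
  by rewrite add0n mul0n expr0 qfact0 gbin0 !mulr1 mul1r.
elim: j => [|j IHj].
  by rewrite addn0 muln0 expr0 qfact0 gbin_nn !mulr1.
rewrite addSn gbinS mulrDr.
transitivity (qint q i.+1 * (qfact q (i + j.+1) * q ^+ (i * j.+1)) +
  q ^+ 2 ^+ i.+1 * qint q j.+1 * (qfact q (i.+1 + j) * q ^+ (i.+1 * j)));
  last by rewrite IHi IHj !qfactS addSnnS; ring.
rewrite addSnnS qfactS -[(i + j.+1).+1]/(i.+1 + j.+1)%N qintD -!exprM.
rewrite mulrDr mulrDl; congr (_ + _).
  by rewrite mulSn exprD; have ? := expf_neq0 j.+1 q_neq0; field.
by rewrite mulnS mul2n -addnn !exprD; ring.
Qed.

End QuantumFactorial.

(** * Values of quantum binomials, and the root of unity *)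

Section LaurentValue.
Variables (F : fieldType) (z : F).
Hypothesis z_neq0 : z != 0.

Lemma qvar_neq0 : qvar != 0.
Proof. by rewrite /qvar tofrac_eq0 polyX_eq0. Qed.

Lemma qint_qvar_neq0 k : (0 < k)%N -> qint qvar k != 0.
Proof.
have sub_inv_neq0 n : (0 < n)%N -> qvar ^+ n - qvar ^- n != 0.
  move=> n_gt0; have qn0 := expf_neq0 n qvar_neq0.
  rewrite subr_eq0; apply/negP => /eqP /(congr1 ( *%R (qvar ^+ n))).
  rewrite mulfV // -exprD => /eqP; rewrite /qvar -tofracXn -tofrac1 tofrac_eq.
  move=> /eqP /(congr1 (fun p : {poly int} => size p)).
  by rewrite size_polyXn size_poly1 => -[]; case: n n_gt0 {qn0}.
by move=> k_gt0; rewrite mulf_neq0 ?invr_eq0 ?sub_inv_neq0 // (sub_inv_neq0 1).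
Qed.

(** [xget] picks one representation p / q^N among many; cross-multiplying two of them in Z[q] shows
    that they evaluate alike. *)
Lemma laurent_valueE f N (p : {poly int}) :
  f * qvar ^+ N = tofrac p ->
  laurent_value z f = (map_poly intr p).[z] / z ^+ N.
Proof.
move=> fE; rewrite /laurent_value; case: xgetP => [c _ [N' [p' [fE' ->]]]|nex].
  apply/eqP; rewrite eqr_div ?expf_neq0 //; apply/eqP.
  have : p' * 'X^N = p * 'X^N'.
    apply/eqP; rewrite -tofrac_eq !tofracM !tofracXn -/qvar -fE -fE'.
    by rewrite mulrAC.
  move=> /(congr1 (fun s : {poly int} => (map_poly (intr : int -> F) s).[z])).
  by rewrite !rmorphM /= !map_polyXn !hornerM !hornerXn.
by case: (nex ((map_poly intr p).[z] / z ^+ N)); exists N, p.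
Qed.

(** Over Z[q] the binomial is [gbin] at X^2 divided by X^(ij), and evaluation at [z], a ring
    morphism, passes through [gbin]. *)
Lemma qbinom_at_gbin i j :
  qbinom_at z (i + j) i = gbin (z ^+ 2) (i + j) i / z ^+ (i * j).
Proof.
have nz n : qfact qvar n != 0.
  by apply: qfact_neq0 => k /andP[k_gt0 _]; apply: qint_qvar_neq0.
rewrite /qbinom_at (@laurent_valueE _ (i * j) (gbin 'X^2 (i + j) i)).
  have -> : map_poly intr (gbin 'X^2 (i + j) i) =
      gbin 'X^2 (i + j) i :> {poly F}.
    by rewrite (rmorph_gbin (map_poly (intr : int -> F))) /= map_polyXn.
  by rewrite -/(horner_eval z _) rmorph_gbin /= /horner_eval hornerXn.
rewrite /qbinom addKn mulrAC qfactD ?qvar_neq0 // mulrC mulKf ?mulf_neq0 //.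
by rewrite (rmorph_gbin (@tofrac _)) /= tofracXn.
Qed.

Lemma qbinom_atE i j : (forall k, (0 < k < (i + j).+1)%N -> qint z k != 0) ->
  qbinom_at z (i + j) i = qfact z (i + j) / (qfact z i * qfact z j).
Proof.
move=> nz; rewrite qbinom_at_gbin.
have nzf n : (n <= i + j)%N -> qfact z n != 0.
  by move=> n_le; apply: qfact_neq0 => k kn; apply: nz; lia.
apply/eqP; rewrite eqr_div ?mulf_neq0 ?expf_neq0 ?nzf ?leq_addl ?leq_addr //.
by rewrite qfactD // mulrC.
Qed.

End LaurentValue.

(** * Primitivity of [zeta] *)

Lemma zetaX (R : realType) r k :
  zeta R r ^+ k =
  (cos (k%:R * (2 * pi / r%:R)) +i* sin (k%:R * (2 * pi / r%:R)))%C.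
Proof.
elim: k => [|k IHk]; first by rewrite expr0 mul0r cos0 sin0.
rewrite exprSr IHk /zeta -[k.+1%:R]natr1 [(k%:R + 1) * _]mulrDl mul1r cosD sinD.
by apply/eqP; rewrite eq_complex /=; apply/andP; split; apply/eqP; ring.
Qed.

Lemma zeta_primitive (R : realType) r :
  (0 < r)%N -> r.-primitive_root (zeta R r).
Proof.
move=> r_gt0; have r_neq0 : r%:R != 0 :> R by rewrite pnatr_eq0 -lt0n.
have zr : zeta R r ^+ r = 1.
  rewrite zetaX mulrCA divff // mulr1 mulr_natl cos2pi.
  by rewrite sin_mulr2n sinpi mulr0 mul0rn.
have [k prim_k k_dvd] := prim_order_exists r_gt0 zr.
have [k_eq|k_neq] := eqVneq k r; first by rewrite k_eq in prim_k.
have k_lt : (k < r)%N by rewrite ltn_neqAle k_neq dvdn_leq.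
have k_gt0 := prim_order_gt0 prim_k.
have := prim_expr_order prim_k; rewrite zetaX => /eqP.
rewrite eq_complex /= => /andP[/eqP + _].
(* If the order k were less than r, cos(2 pi k/r) = 1 would force sin(pi k/r) = 0 by the double
   angle formula, whereas 0 < pi k/r < pi. *)
have -> : k%:R * (2 * pi / r%:R) = (k%:R / r%:R * pi) *+ 2 :> R.
  by rewrite -mulr_natl; field.
rewrite cos_mulr2n cos2sin2.
have : 0 < sin (k%:R / r%:R * pi : R).
  apply: sin_gt0_pi; rewrite mulr_gt0 ?divr_gt0 ?ltr0n ?pi_gt0 //=.
  by rewrite gtr_pMl ?pi_gt0 // ltr_pdivrMr ?ltr0n // mul1r ltr_nat.
by move=> /[swap] h /(exprn_gt0 2); lra.
Qed.

(** * Scalar identities at a root of unity *)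

(** The exponents contain rounded halves; this and [half_add3] say that the halving is exact, in a
    form that [nia] can use. *)
Lemma half_pred n : ((n * (n - 1))./2 * 2 = n * (n - 1))%N.
Proof.
have := odd_double_half (n * (n - 1)); rewrite oddM -muln2.
by case: n => //= n; rewrite subn1 /=; case: (odd n).
Qed.

Lemma half_add3 n : (((n + 3) * n)./2 * 2 = (n + 3) * n)%N.
Proof.
have := odd_double_half ((n + 3) * n); rewrite oddM oddD -muln2.
by case: (odd n).
Qed.

Section RootOfUnity.
Variables (C : fieldType) (z : C) (r : nat).
Hypotheses (r_odd : odd r) (r_gt1 : (1 < r)%N) (z_prim : r.-primitive_root z).

Lemma root_neq0 : z != 0.
Proof. by rewrite (prim_root_eq0 z_prim); case: r r_gt1. Qed.

Let zX_neq0 n : z ^+ n != 0 := expf_neq0 n root_neq0.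

(** Since r is odd, 2 cancels modulo r. *)
Lemma expr_double_inj i j : z ^+ (2 * i) = z ^+ (2 * j) -> z ^+ i = z ^+ j.
Proof.
wlog ji : i j / (j <= i)%N => [wlog_ji|].
  by case: (leqP j i) => [/wlog_ji//|/ltnW ij e]; apply/esym/wlog_ji.
move=> /eqP; rewrite (eq_prim_root_expr z_prim) eqn_mod_dvd ?leq_mul // -mulnBr.
rewrite Gauss_dvdr ?coprimen2 // -eqn_mod_dvd // => /eqP e; apply/eqP.
by rewrite (eq_prim_root_expr z_prim) e.
Qed.

Lemma qint_root_neq0 k : (0 < k < r)%N -> qint z k != 0.
Proof.
have sub_inv_neq0 n : (0 < n < r)%N -> z ^+ n - z ^- n != 0.
  move=> /andP[n_gt0 n_lt]; rewrite subr_eq0; apply/negP => /eqP e.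
  have : z ^+ (2 * n) = z ^+ (2 * 0).
    by rewrite mul2n -addnn exprD {1}e mulVf.
  move/expr_double_inj/eqP; rewrite (eq_prim_root_expr z_prim) mod0n.
  by rewrite modn_small // eqn0Ngt n_gt0.
move=> k_in; rewrite mulf_neq0 ?invr_eq0 ?sub_inv_neq0 //.
by rewrite (sub_inv_neq0 1).
Qed.

Lemma qfact_root_neq0 n : (n < r)%N -> qfact z n != 0.
Proof.
by move=> n_lt; apply: qfact_neq0 => k kn; apply: qint_root_neq0; lia.
Qed.

Lemma qint_root_opp i j : (i + j)%N = r -> qint z i = - qint z j.
Proof.
move=> ij; have : z ^+ i * z ^+ j = 1.
  by rewrite -exprD ij (prim_expr_order z_prim).
move=> /(canRL (mulfK (zX_neq0 j))); rewrite mul1r => e.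
by rewrite /qint e invrK -mulNr opprB.
Qed.

(** Cross-multiplied form of [k+s choose s] = (-1)^s [n choose s]: each step replaces [k+s+1] by
    -[n-s], as the two arguments add up to r. *)
Lemma qfact_root_complement n k s : (n + k).+1 = r -> (s <= n)%N ->
  qfact z (k + s) * qfact z (n - s) = (-1) ^+ s * (qfact z k * qfact z n).
Proof.
move=> nk; elim: s => [|s IHs] s_le; first by rewrite addn0 subn0 expr0 mul1r.
have := IHs (ltnW s_le).
have -> : (n - s)%N = (n - s.+1).+1 by lia.
rewrite qfactS mulrA => h.
rewrite addnS qfactS (@qint_root_opp _ (n - s.+1).+1); last by lia.
rewrite exprS -!mulrA -h; ring.
Qed.

Definition tw i m : C :=
  z ^+ (2 * (m + 1) * m) * z ^+ (((i + 3) * i)./2 + 2 * m * i).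
Definition itw i m : C := (-1) ^+ i / tw i m.

Lemma tw_neq0 i m : tw i m != 0.
Proof. by rewrite mulf_neq0. Qed.

Lemma twS i m : tw i.+1 m = tw i m * z ^+ (i + 2 * m.+1).
Proof.
rewrite /tw -!exprD; congr (z ^+ _).
have := half_add3 i; have := half_add3 i.+1; nia.
Qed.

Lemma tw_succ i m : tw i m.+1 = tw i m * z ^+ (i + 2 * m.+1) ^+ 2.
Proof. by rewrite /tw -!exprM -!exprD; congr (z ^+ _); nia. Qed.

(** T_m depends only on m mod r, so its coefficients must too; raising m by r changes each exponent
    by a multiple of r. *)
Lemma tw_mod i m : tw i (m %% r) = tw i m.
Proof.
rewrite {2}(divn_eq m r) addnC.
elim: (m %/ r)%N => [|k IHk]; first by rewrite addn0.
rewrite IHk mulSnr addnA.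
have zr1 n : z ^+ (n * r) = 1.
  by rewrite mulnC exprM (prim_expr_order z_prim) expr1n.
move: (m %% r + k * r)%N => n; rewrite /tw.
have -> : (2 * (n + r + 1) * (n + r) =
    2 * (n + 1) * n + (2 * (2 * n + r + 1)) * r)%N.
  by ring.
have -> : (2 * (n + r) * i = 2 * n * i + (2 * i) * r)%N by ring.
by rewrite addnA [z ^+ (_ + _ * r)]exprD zr1 [z ^+ (_ + _ * r)]exprD zr1 !mulr1.
Qed.

Lemma itw_mod i m : itw i (m %% r) = itw i m.
Proof. by rewrite /itw tw_mod. Qed.

(* The condition on [c] under which [\sum_m \sum_i c i m E^i F^(i) T_m]
   commutes with [E]. *)
Definition E_balanced (c : nat -> nat -> C) := forall i m,
  c i m.+1 = c i m - c i.+1 m * (z ^- (i + 2 * m.+1) - z ^+ (i + 2 * m.+1)).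

(** With x = z^(i + 2(m+1)), the recursion reads x^2 = 1 - x(x^-1 - x); for [itw] it reads x^-2 = 1
    + x^-1(x^-1 - x). *)
Lemma tw_balanced : E_balanced tw.
Proof.
move=> i m; rewrite tw_succ twS.
by move: (z ^+ _) (zX_neq0 (i + 2 * m.+1)) => x ?; field.
Qed.

Lemma itw_balanced : E_balanced itw.
Proof.
move=> i m; rewrite /itw tw_succ twS [(-1) ^+ i.+1]exprS.
have ? := tw_neq0 i m.
by move: (z ^+ _) (zX_neq0 (i + 2 * m.+1)) => x ?; field; apply/andP.
Qed.

(** For fixed k = i + j, the ratio of [tw j (m + i)] to [tw i m] depends on i only through z^(ik -
    i). This reduces both convolutions below to [qbin_alt_sum0]. *)
Lemma tw_shift i j m :
  tw j (m + i) * tw 0 m * z ^+ i = tw i m * tw (i + j) m * z ^+ (i * (i + j)).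
Proof.
rewrite /tw -!exprD; congr (z ^+ _).
have := half_add3 i; have := half_add3 j; have := half_add3 (i + j).
have := half_add3 0. nia.
Qed.

Lemma qbin_alt_sum0 k : (0 < k < r)%N ->
  \sum_(i < k.+1) (-1) ^+ i * z ^+ (i * k) / z ^+ i /
    (qfact z i * qfact z (k - i)) = 0.
Proof.
move=> /andP[k_gt0 k_lt].
transitivity ((qfact z k)^-1 *
    \sum_(i < k.+1) (-1) ^+ i * z ^+ 2 ^+ 'C(i, 2) * gbin (z ^+ 2) k i);
  last by rewrite gbin_alt_sum0 ?mulr0.
rewrite mulr_sumr; apply: eq_bigr => -[i /= i_lt] _.
have [j kE] : exists j, k = (i + j)%N by exists (k - i)%N; lia.
rewrite kE addKn in k_lt *.
(* The part z^(ij) turns the symmetric binomial into [gbin] at z^2; the part z^(2 C(i,2)) is the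
   weight of [gbin_alt_sum0]. *)
have -> : (i * (i + j) = i * j + i + 2 * 'C(i, 2))%N.
  rewrite bin2 -subn1; have := half_pred i.
  by case: i {i_lt kE k_lt} => [|i] /=; nia.
have nzk := qfact_root_neq0 k_lt.
have nzi : qfact z i != 0 by apply: qfact_root_neq0; lia.
have nzj : qfact z j != 0 by apply: qfact_root_neq0; lia.
have zi := zX_neq0 i; have zij := zX_neq0 (i * j).
have -> : gbin (z ^+ 2) (i + j) i =
    qfact z (i + j) * z ^+ (i * j) / (qfact z i * qfact z j).
  by rewrite qfactD ?root_neq0 // mulrC mulKf ?mulf_neq0.
rewrite [z ^+ (_ + 2 * _)]exprD [z ^+ (_ + i)]exprD [z ^+ (2 * _)]exprM.
by field; do !(apply/andP; split).
Qed.

Lemma itw_tw_sum k m : (0 < k < r)%N ->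
  \sum_(i < k.+1) itw i m * tw (k - i) (m + i) /
    (qfact z i * qfact z (k - i)) = 0.
Proof.
move=> k_in.
transitivity (tw k m / tw 0 m *
  \sum_(i < k.+1) (-1) ^+ i * z ^+ (i * k) / z ^+ i /
    (qfact z i * qfact z (k - i))); last by rewrite qbin_alt_sum0 ?mulr0.
rewrite mulr_sumr; apply: eq_bigr => -[i /= i_lt] _.
have := tw_shift i (k - i) m; have -> : (i + (k - i) = k)%N by lia.
have ? := zX_neq0 i; have ? := tw_neq0 i m; have ? := tw_neq0 0 m.
rewrite -mulrA => /(canRL (mulfK _)) ->; last by rewrite mulf_neq0.
have : qfact z i != 0 by apply: qfact_root_neq0; lia.
have : qfact z (k - i) != 0 by apply: qfact_root_neq0; lia.
by rewrite /itw => ? ?; field; do !(apply/andP; split).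
Qed.

Lemma tw_itw_sum k m : (0 < k < r)%N ->
  \sum_(i < k.+1) tw i m * itw (k - i) (m + i) /
    (qfact z i * qfact z (k - i)) = 0.
Proof.
move=> k_in.
transitivity (tw 0 m / tw k m / z ^+ (k * k) * z ^+ k *
  \sum_(i < k.+1) (-1) ^+ i * z ^+ (i * k) / z ^+ i /
    (qfact z i * qfact z (k - i))); last by rewrite qbin_alt_sum0 ?mulr0.
(* Here the ratio of [tw_shift] occurs inverted; replacing i by k - i restores the sign of the
   exponent at the cost of z^(k - k^2). *)
rewrite [in RHS](reindex_inj rev_ord_inj) /= mulr_sumr.
apply: eq_bigr => -[i /= i_lt] _.
have := tw_shift i (k - i) m; have -> : (i + (k - i) = k)%N by lia.
rewrite subSS subKn //.
have ? := zX_neq0 i; have ? := tw_neq0 i m; have ? := tw_neq0 0 m.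
have ? := tw_neq0 k m; have ? := zX_neq0 (k * k); have ? := zX_neq0 (i * k).
rewrite -mulrA => /(canRL (mulfK _)); rewrite mulf_neq0 // => /(_ isT).
rewrite /itw => ->.
have : qfact z i != 0 by apply: qfact_root_neq0; lia.
have : qfact z (k - i) != 0 by apply: qfact_root_neq0; lia.
have -> : z ^+ k = z ^+ (k - i) * z ^+ i by rewrite -exprD subnK.
have -> : z ^+ (k * k) = z ^+ ((k - i) * k) * z ^+ (i * k).
  by rewrite -exprD -mulnDl subnK.
have ? := zX_neq0 (k - i); have ? := zX_neq0 ((k - i) * k).
by move=> ? ?; field; do !(apply/andP; split).
Qed.

(* The scalar by which the factors z^-t K - z^t K^-1, t < s, produced by normal
   ordering E^j F^j, act on T_m (where K acts by z^(-2m)). *)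
Definition cprod s m : C := \prod_(t < s) (z ^- (t + 2 * m) - z ^+ (t + 2 * m)).

(** Pulling a power of z out of each factor of [cprod] leaves Y - q^t with q = z^2 and Y = z^(-4m),
    a factor of the product in [gbin_newton]. *)
Lemma cprodE k n s m : (n + k).+1 = r -> (s <= n)%N ->
  itw (k + s) m * cprod s m =
  (-1) ^+ s * itw k m * z ^+ (s * (n - s)) *
    \prod_(t < s) (z ^- (4 * m) - z ^+ 2 ^+ t).
Proof.
move=> nk; elim: s => [|s IHs] s_le.
  by rewrite /cprod !big_ord0 addn0 mul0n !expr0; ring.
rewrite /cprod !big_ord_recr /= -/(cprod s m).
have : itw (k + s.+1) m = - itw (k + s) m / z ^+ (k + s + 2 * m.+1).
  rewrite /itw addnS twS exprS.
  have ? := zX_neq0 (k + s + 2 * m.+1); have ? := tw_neq0 (k + s) m.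
  by field; apply/andP.
move=> ->; rewrite mulrA [_ / _ * _]mulrAC mulNr IHs ?(ltnW s_le) //.
have z4 : z ^+ (4 * m) = z ^+ (2 * m) ^+ 2.
  by rewrite -exprM; congr (_ ^+ _); lia.
have -> : z ^+ (s * (n - s)) =
    z ^+ (s.+1 * (n - s.+1)) * z ^+ (k + s + 2 * m.+1) * z ^+ s / z ^+ (2 * m).
  apply: (canRL (mulfK (zX_neq0 _))); rewrite -!exprD.
  (* The two exponents agree only modulo r; this is where n + k + 1 = r enters. *)
  have -> : (s.+1 * (n - s.+1) + (k + s + 2 * m.+1) + s =
      s * (n - s) + 2 * m + r)%N.
    have [d nE] : exists d, n = (s.+1 + d)%N by exists (n - s.+1)%N; lia.
    have [-> ->] : (n - s = d.+1 /\ n - s.+1 = d)%N by lia.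
    by rewrite -nk nE; nia.
  by rewrite [z ^+ (_ + r)]exprD (prim_expr_order z_prim) mulr1.
rewrite z4 -(exprM z 2 s) (mulnC 2%N s) (exprM z s 2) [z ^+ (s + _)]exprD.
have := zX_neq0 s; have := zX_neq0 (2 * m).
have := zX_neq0 (k + s + 2 * m.+1); rewrite [(-1) ^+ s.+1]exprS.
move: (z ^+ (_ + _)) (z ^+ s) (z ^+ (2 * m)) => x y w x0 w0 y0.
by field; do !(apply/andP; split).
Qed.

Lemma itw_reorder k m : (k < r)%N ->
  \sum_(s < (r - k)) itw (k + s) m * cprod s m * qfact z (k + s) / qfact z s =
  itw k m * z ^+ (4 * m * k.+1) * qfact z k.
Proof.
move=> k_lt; have [n nk] : exists n, (n + k).+1 = r by exists (r - k.+1)%N; lia.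
have -> : (r - k = n.+1)%N by lia.
(* As n + (k+1) = r, the power on the right is Y^n for Y = z^(-4m), the value of the Newton sum. *)
have -> : z ^+ (4 * m * k.+1) = z ^- (4 * m) ^+ n.
  rewrite exprVn -[RHS]mul1r -exprM; apply: (canRL (mulfK (zX_neq0 _))).
  rewrite -exprD -mulnDr addnC addnS nk mulnC exprM.
  by rewrite (prim_expr_order z_prim) expr1n.
rewrite -(gbin_newton (z ^+ 2)) mulrAC mulr_sumr.
apply: eq_bigr => -[s /= s_lt] _.
rewrite (@cprodE _ n) //.
have := @qfact_root_complement n k s nk; rewrite -ltnS s_lt => /(_ isT).
have := qfactD root_neq0 s (n - s); rewrite subnKC //.
have hs : qfact z s != 0 by apply: qfact_root_neq0; lia.
have hn : qfact z n != 0 by apply: qfact_root_neq0; lia.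
have hns : qfact z (n - s) != 0 by apply: qfact_root_neq0; lia.
move=> e1 /(canRL (mulfK hns)) ->.
have -> : gbin (z ^+ 2) n s =
    qfact z n * z ^+ (s * (n - s)) / (qfact z s * qfact z (n - s)).
  by rewrite e1 mulrC mulKf // mulf_neq0.
have sg : (-1) ^+ s * (-1) ^+ s = 1 :> C.
  by rewrite -exprD addnn -signr_odd odd_double.
set P := \prod_(_ < _) _.
transitivity ((-1) ^+ s * (-1) ^+ s * itw k m * z ^+ (s * (n - s)) * P *
  qfact z k * qfact z n / qfact z (n - s) / qfact z s).
  by field; apply/andP.
by rewrite sg; field; apply/andP.
Qed.

End RootOfUnity.

(** * Normal ordering in the small quantum group *)

Lemma sum_antidiagonal (V : nmodType) n (G : nat -> nat -> V) :
  \sum_(k < n) \sum_(i < k.+1) G i (k - i)%N =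
  \sum_(i < n) \sum_(j < n - i) G i j.
Proof.
elim: n => [|n IHn]; first by rewrite !big_ord0.
rewrite big_ord_recr /= IHn.
transitivity (\sum_(i < n.+1) (\sum_(j < n - i) G i j + G i (n - i)%N)).
  by rewrite big_split /= [X in _ = X + _]big_ord_recr /= subnn big_ord0 addr0.
by apply: eq_bigr => i _; rewrite subSn ?big_ord_recr // -ltnS.
Qed.

(* Locking keeps [rewrite -scalerAl] from looking inside [uT]. *)
HB.lock Definition uTl (C : fieldType) (z : C) r := uT z r.

Section SmallQuantumGroup.
Variables (C : fieldType) (z : C) (r : nat).
Hypotheses (r_odd : odd r) (r_gt1 : (1 < r)%N) (z_prim : r.-primitive_root z).

Local Notation E := (uE z r).
Local Notation F := (uF z r).
Local Notation K := (uK z r).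
Local Notation T := (uTl z r).
Local Notation Fd := (uFd z r).
Implicit Types (x y : uz z r) (a : C).

Let r_gt0 : (0 < r)%N := ltnW r_gt1.
Let z_neq0 : z != 0 := root_neq0 r_gt1 z_prim.
Let zX_neq0 n : z ^+ n != 0 := expf_neq0 n z_neq0.
Let zr1 n : z ^+ n ^+ r = 1.
Proof. by rewrite -exprM mulnC exprM (prim_expr_order z_prim) expr1n. Qed.

(** For a distinct from 1 the sum is killed by a - 1; for a = 1 one divides by r, which is nonzero
    in [C] because a primitive r-th root exists. *)
Lemma geometric_mean a : a ^+ r = 1 ->
  r%:R^-1 * (\sum_(b < r) a ^+ b) = (a == 1)%:R.
Proof.
move=> ar1; have [->|a_neq1] := eqVneq a 1.
  under eq_bigr do rewrite expr1n.
  by rewrite sumr_const card_ord mulVf // (prim_root_natf_neq0 z_prim).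
have /esym/eqP := subrX1 a r; rewrite ar1 subrr mulf_eq0 subr_eq0.
by rewrite (negbTE a_neq1) => /eqP ->; rewrite mulr0.
Qed.

Lemma uTE m : T m = r%:R^-1 *: \sum_(b < r) (z ^+ (2 * m) *: K) ^+ b.
Proof.
rewrite uTl.unlock; congr (_ *: _); apply: eq_bigr => b _.
by rewrite exprZn -exprM.
Qed.

Lemma uT_mod m : T (m %% r) = T m.
Proof.
rewrite !uTE; suff -> : z ^+ (2 * (m %% r)) = z ^+ (2 * m) by [].
by rewrite mulnC exprM (prim_expr_mod z_prim) -exprM mulnC.
Qed.

(** X = z^(2m) K satisfies X^r = 1, so multiplication by X fixes the sum of its powers. *)
Lemma uK_uT m : K * T m = z ^- (2 * m) *: T m.
Proof.
rewrite uTE; set X := _ *: K.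
have Xr : X ^+ r = 1 by rewrite exprZn zr1 scale1r uK_exp.
have /esym/eqP := subrX1 X r; rewrite Xr subrr mulrBl mul1r subr_eq0 => /eqP XS.
rewrite -scalerAr -[in RHS]XS -scalerAl !scalerA; congr (_ *: _).
by field; rewrite zX_neq0 (prim_root_natf_neq0 z_prim).
Qed.

Lemma uT_eigen m x a : K * x = a *: x -> a ^+ r = 1 ->
  T m * x = (z ^+ (2 * m) * a == 1)%:R *: x.
Proof.
move=> Kx ar1; rewrite -geometric_mean; last by rewrite exprMn zr1 ar1 mulr1.
rewrite uTE -scalerAl mulr_suml -scalerA scaler_suml; congr (_ *: _).
apply: eq_bigr => -[b /= _] _; rewrite exprZn exprMn -scalerAl.
suff -> : K ^+ b * x = a ^+ b *: x by rewrite scalerA.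
elim: b => [|b IHb]; first by rewrite !expr0 mul1r scale1r.
by rewrite exprSr -mulrA Kx -scalerAr IHb scalerA -exprS.
Qed.

Lemma z2_inj i j : (i < r)%N -> (j < r)%N ->
  z ^+ (2 * i) = z ^+ (2 * j) -> i = j.
Proof.
move=> i_lt j_lt /(expr_double_inj r_odd z_prim)/eqP.
by rewrite (eq_prim_root_expr z_prim) !modn_small // => /eqP.
Qed.

Lemma uT_orth i j : (i < r)%N -> (j < r)%N -> T i * T j = (i == j)%:R *: T j.
Proof.
move=> i_lt j_lt; rewrite (uT_eigen _ (uK_uT j)).
  2: by rewrite exprVn zr1 invr1.
congr (_%:R *: _); rewrite (can2_eq (mulfVK _) (mulfK _)) // mul1r.
by congr nat_of_bool; apply/eqP/eqP => [/z2_inj|->//]; apply.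
Qed.

Lemma uT_sum : \sum_(m < r) T m = 1.
Proof.
rewrite uTl.unlock -scaler_sumr exchange_big /=.
transitivity (\sum_(b < r) (b == 0 :> nat)%:R *: K ^+ b).
  rewrite scaler_sumr; apply: eq_bigr => b _.
  rewrite -scaler_suml scalerA.
  under eq_bigr do rewrite mulnAC exprM.
  rewrite geometric_mean ?zr1 //; congr (_%:R *: _).
  congr nat_of_bool; apply/eqP/eqP => [|->//].
  by rewrite -(expr0 z) => /(@z2_inj b 0); apply.
rewrite (bigD1 (Ordinal r_gt0)) //= scale1r big1 ?addr0 // => b.
by rewrite -val_eqE /= => /negbTE ->; rewrite scale0r.
Qed.

(** Cyclicity of the index supplies the successor form in which [uT_E] and [uT_F] apply. *)
Lemma uT_pred m : exists n, T m = T n.+1.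
Proof.
by exists (m + r.-1)%N; rewrite -addnS prednK // -[RHS]uT_mod modnDr uT_mod.
Qed.

Lemma eq_on_uT x y : (forall m, x * T m.+1 = y * T m.+1) -> x = y.
Proof.
move=> xy; rewrite -[x]mulr1 -[y]mulr1 -uT_sum !mulr_sumr.
by apply: eq_bigr => m _; have [n ->] := uT_pred m.
Qed.

Lemma uT_skew x a m n : K * x = a *: (x * K) ->
  z ^+ (2 * m) * a = z ^+ (2 * n) -> T m * x = x * T n.
Proof.
move=> Kx e; rewrite !uTE -scalerAl -scalerAr mulr_suml mulr_sumr.
congr (_ *: _).
apply: eq_bigr => -[b /= _] _; rewrite !exprZn -e exprMn -scalerAl -scalerAr.
rewrite -scalerA; congr (_ *: _).
elim: b => [|b IHb]; first by rewrite !expr0 mul1r mulr1 scale1r.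
by rewrite exprSr -mulrA Kx -scalerAr mulrA IHb -scalerAl scalerA -exprS mulrA.
Qed.

Lemma uT_F m : T m.+1 * F = F * T m.
Proof.
apply: (uT_skew (uKF_comm z r_gt0)).
by rewrite mulnS exprD mulrAC mulfV ?mul1r.
Qed.

Lemma uT_E m : T m * E = E * T m.+1.
Proof. by apply: (uT_skew (uKE_comm z r_gt0)); rewrite mulnS addnC exprD. Qed.

Lemma uT_FX m n : T (m + n) * F ^+ n = F ^+ n * T m.
Proof.
elim: n => [|n IHn]; first by rewrite addn0 expr0 mulr1 mul1r.
by rewrite addnS exprS mulrA uT_F -!mulrA IHn.
Qed.

Lemma uT_Fd m n : T (m + n) * Fd n = Fd n * T m.
Proof.
rewrite /uFd; case: ifP => _; last by rewrite mulr0 mul0r.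
by rewrite -[RHS]scalerAl -[LHS]scalerAr uT_FX.
Qed.

Lemma uT_FE m : T m * (F * E) = F * E * T m.
Proof.
have [n ->] := uT_pred m.
by rewrite mulrA uT_F -mulrA uT_E mulrA.
Qed.

(** On a K-eigenvector the commutator K - K^-1 is a scalar; the reorderings below rest on this. *)
Lemma uEF_eigen x a : a != 0 -> K * x = a *: x ->
  E * F * x = F * E * x + (a - a^-1) *: x.
Proof.
move=> a0 Kx; have Ku := uK_unit z r_gt0.
have Kix : K^-1 * x = a^-1 *: x.
  by apply: (mulrI Ku); rewrite mulVKr // -scalerAr Kx scalerA mulVf ?scale1r.
have /eqP := uEF z r_gt0; rewrite subr_eq => /eqP ->.
by rewrite mulrDl mulrBl Kx Kix scalerBl addrC.
Qed.

Lemma uK_EX_uT (a m : nat) :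
  K * (E ^+ a * T m) = (z ^+ (2 * a) / z ^+ (2 * m)) *: (E ^+ a * T m).
Proof.
elim: a => [|a IHa]; first by rewrite !expr0 !mul1r uK_uT.
rewrite exprS -mulrA [LHS]mulrA (uKE_comm z r_gt0) -scalerAl -mulrA IHa.
by rewrite -scalerAr scalerA [_ * (_ / _)]mulrA -exprD -mulnS.
Qed.

(** Closed forms of sums of K-eigenvalue differences: [cF] arises on moving E past j+1 factors F,
    [cE] on moving F past [a] factors E. *)
Definition cF j m : C := qint z j.+1 * (z ^- (j + 2 * m) - z ^+ (j + 2 * m)).
Definition cE (a m : nat) : C :=
  qint z a * (z ^+ a.+1 / z ^+ (2 * m) - z ^+ (2 * m) / z ^+ a.+1).

Let z2_neq1 : z * z - 1 != 0.
Proof.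
have := qint_root_neq0 r_odd r_gt1 z_prim (k := 1); rewrite r_gt1 => /(_ isT).
rewrite /qint expr1 mulf_eq0 negb_or => /andP[+ _]; apply: contraNneq => zz.
have -> : z - z^-1 = (z * z - 1) / z by field.
by rewrite zz mul0r.
Qed.

Lemma cFS j m : cF j.+1 m = z ^- (2 * m) - z ^+ (2 * m) + cF j m.+1.
Proof.
rewrite /cF addSn mulnS addnCA !add2n !exprS exprD /qint !exprS.
have := zX_neq0 j; have := zX_neq0 (2 * m).
move: (z ^+ j) (z ^+ (2 * m)) z2_neq1 => x w zz w0 x0.
by field; do ?[apply/andP; split].
Qed.

Lemma cES (a m : nat) : cE a.+1 m =
  z ^+ (2 * a.+1) / z ^+ (2 * m) - z ^+ (2 * m) / z ^+ (2 * a.+1) + cE a m.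
Proof.
rewrite /cE mulnS mul2n -addnn !add2n !exprS !exprD /qint !exprS.
have := zX_neq0 a; have := zX_neq0 (2 * m).
move: (z ^+ a) (z ^+ (2 * m)) z2_neq1 => x w zz w0 x0.
by field; do ?[apply/andP; split].
Qed.

(** The last F is peeled off; carrying it past T_m raises the index, whence the m+1 in [cFS]. *)
Lemma uE_FX_uT n m :
  E * F ^+ n.+1 * T m = F ^+ n.+1 * E * T m + cF n m *: (F ^+ n * T m).
Proof.
elim: n m => [|n IHn] m.
  rewrite (uEF_eigen _ (uK_uT m)) ?invr_neq0 // invrK.
  have q1 : qint z 1 = 1 by rewrite /qint; field; rewrite z_neq0.
  by rewrite /cF q1 add0n expr0 expr1 !mul1r.
rewrite exprSr !mulrA -[_ * F * _]mulrA -uT_F mulrA IHn mulrDl.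
rewrite -[_ * E * _]mulrA -!scalerAl -![_ * T m.+1 * F]mulrA uT_F.
rewrite -[_ * (E * _) * _]mulrA -[E * _ * F]mulrA uT_F !mulrA.
rewrite -[_ * E * F]mulrA -[_ * (E * F) * _]mulrA.
rewrite (uEF_eigen _ (uK_uT m)) ?invr_neq0 // invrK cFS mulrDr -!scalerAr.
by rewrite !scalerDl -!exprSr !mulrA !addrA -exprSr.
Qed.

Lemma uEX_FE_uT (a m : nat) :
  E ^+ a * (F * E) * T m = F * E ^+ a.+1 * T m + cE a m *: (E ^+ a * T m).
Proof.
elim: a => [|a IHa].
  by rewrite expr0 mul1r expr1 /cE qint0 mul0r scale0r addr0.
have lam_neq0 : z ^+ (2 * a.+1) / z ^+ (2 * m) != 0.
  by rewrite mulf_neq0 ?invr_neq0.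
rewrite [E ^+ a.+1]exprS -[LHS]mulrA -[_ * E ^+ a * _]mulrA mulrA.
rewrite -[E * _ * _]mulrA [_ * (_ * T m)]mulrA IHa mulrDr -scalerAr.
rewrite -[F * _ * T m]mulrA mulrA -exprS (uEF_eigen lam_neq0 (uK_EX_uT _ _)).
rewrite invf_div cES scalerDl addrA [E * (_ * _)]mulrA -exprS.
by rewrite -!mulrA [E * (_ * _)]mulrA -exprS.
Qed.

(** The factorials form [j choose k]^2 [j-k]!, the usual weight of F^k E^k in the normal ordering of
    E^j F^j. *)
Definition reorder_coef j k m : C :=
  qfact z j ^+ 2 / (qfact z k ^+ 2 * qfact z (j - k)) * cprod z (j - k) m.

(** What remains of the recursion [reorder_coefS] once its common factors are cancelled. *)
Lemma cE_cF (a s m : nat) :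
  (cE a m + cF (a + s) m) * qint z s.+1 =
  (qint z (a + s).+1 ^+ 2 - qint z a ^+ 2) *
    (z ^- (s + 2 * m) - z ^+ (s + 2 * m)).
Proof.
rewrite /cE /cF /qint; move: (2 * m)%N => p; rewrite !exprS !exprD.
have := zX_neq0 a; have := zX_neq0 s; have := zX_neq0 p.
move: (z ^+ a) (z ^+ s) (z ^+ p) z2_neq1 => x y w zz w0 y0 x0.
by field; do ?[apply/andP; split].
Qed.

Lemma reorder_coef_nn j m : (j < r)%N -> reorder_coef j j m = 1.
Proof.
move=> j_lt; rewrite /reorder_coef subnn qfact0 /cprod big_ord0 !mulr1.
by rewrite divff // expf_neq0 ?(qfact_root_neq0 r_odd r_gt1 z_prim).
Qed.

Lemma reorder_coefS (a s m : nat) : ((a + s).+1 < r)%N ->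
  reorder_coef (a + s).+1 a m =
  (if a is a'.+1 then reorder_coef (a + s) a' m else 0) +
  reorder_coef (a + s) a m * (cE a m + cF (a + s) m).
Proof.
move=> lt_r; have qn n : (n <= (a + s).+1)%N -> qfact z n != 0.
  by move=> ?; apply: (qfact_root_neq0 r_odd r_gt1 z_prim); lia.
have qin n : (0 < n <= (a + s).+1)%N -> qint z n != 0.
  by move=> ?; apply: (qint_root_neq0 r_odd r_gt1 z_prim); lia.
have cS : cprod z s.+1 m = cprod z s m * (z ^- (s + 2 * m) - z ^+ (s + 2 * m)).
  by rewrite /cprod big_ord_recr.
have qs : qint z s.+1 != 0 by apply: qin; lia.
have := cE_cF a s m => /(canRL (mulfK qs)) ->.
rewrite /reorder_coef; have -> : ((a + s).+1 - a = s.+1)%N by lia.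
rewrite addKn cS !qfactS.
have qfs : qfact z s != 0 by apply: qn; lia.
have qfas : qfact z (a + s) != 0 by apply: qn; lia.
move: (z ^- _ - _) cS => p cS.
case: a qn qin {lt_r} qfas => [|a] qn qin qfas.
  by rewrite qint0 qfact0; field; apply/andP.
have -> : (a.+1 + s - a = s.+1)%N by lia.
have qfa : qfact z a != 0 by apply: qn; lia.
have qa : qint z a.+1 != 0 by apply: qin; lia.
by rewrite cS !qfactS; field; do !(apply/andP; split).
Qed.

Lemma uEX_FX_uT j m : (j < r)%N ->
  E ^+ j * F ^+ j * T m =
  \sum_(k < j.+1) reorder_coef j k m *: (F ^+ k * E ^+ k * T m).
Proof.
elim: j => [|j IHj] j_lt.
  by rewrite big_ord1 reorder_coef_nn // scale1r.
have {}IHj := IHj (ltnW j_lt).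
(* Only the E adjacent to F moves; the resulting factor F E commutes with T_m, so the induction
   hypothesis applies at the same m. *)
have -> : E ^+ j.+1 * F ^+ j.+1 * T m =
    (E ^+ j * F ^+ j * T m) * (F * E) + cF j m *: (E ^+ j * F ^+ j * T m).
  rewrite exprSr -!mulrA [E * (_ * _)]mulrA uE_FX_uT mulrDr -!scalerAr.
  by congr (_ + _); rewrite uT_FE exprSr !mulrA.
rewrite IHj scaler_sumr mulr_suml.
have -> :
    \sum_(k < j.+1) reorder_coef j k m *: (F ^+ k * E ^+ k * T m) * (F * E) =
    \sum_(k < j.+1) reorder_coef j k m *: (F ^+ k.+1 * E ^+ k.+1 * T m) +
    \sum_(k < j.+1) (reorder_coef j k m * cE k m) *: (F ^+ k * E ^+ k * T m).
  rewrite -big_split /=; apply: eq_bigr => k _.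
  rewrite -scalerAl -[_ * T m * _]mulrA uT_FE -[_ * _ * (_ * _)]mulrA.
  rewrite [E ^+ k * (_ * _)]mulrA uEX_FE_uT mulrDr scalerDr.
  rewrite -scalerAr scalerA.
  by congr (_ *: _ + _ *: _); rewrite !mulrA // -exprSr.
rewrite -addrA -big_split /=.
rewrite [RHS]big_ord_recr [X in X + _ = _]big_ord_recr /=.
rewrite (reorder_coef_nn _ j_lt) (reorder_coef_nn _ (ltnW j_lt)) !scale1r.
rewrite addrAC; congr (_ + _).
rewrite [RHS](_ : _ = \sum_(k < j.+1)
  ((if k : nat is k'.+1 then reorder_coef j k' m else 0) +
   reorder_coef j k m * (cE k m + cF j m)) *: (F ^+ k * E ^+ k * T m));
  last first.
  apply: eq_bigr => -[k /= k_lt] _; congr (_ *: _).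
  have [s jE] : exists s, j = (k + s)%N by exists (j - k)%N; lia.
  by rewrite jE reorder_coefS // -jE.
under [RHS]eq_bigr do rewrite scalerDl.
rewrite [RHS]big_split /= [X in _ = X + _]big_ord_recl scale0r add0r.
congr (_ + _).
by apply: eq_bigr => k _; rewrite scalerA [cF _ _ * _]mulrC mulrDr scalerDl.
Qed.

End SmallQuantumGroup.

(** * Diagonal elements and the ribbon element *)

(** The correction D i enters H at i+1 but L at i; the vanishing end terms absorb the shift. Both
    sides of the commutation with E have this shape. *)
Lemma sum_shift (V : zmodType) n (H G D L : nat -> V) : (0 < n)%N ->
  H 0 = G 0 -> (forall i, (i.+1 < n)%N -> H i.+1 = G i.+1 - D i) ->
  (forall i, (i.+1 < n)%N -> L i = G i - D i) -> G n.-1 = 0 -> L n.-1 = 0 ->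
  \sum_(i < n) H i = \sum_(i < n) L i.
Proof.
case: n => // n _ H0 HS LE /= Gn Ln.
rewrite [RHS]big_ord_recr /= Ln addr0.
rewrite [RHS](eq_bigr (fun i : 'I_n => G i - D i)) => [|i _].
  2: by apply: LE; rewrite ltnS.
rewrite big_ord_recl /= H0.
rewrite (eq_bigr (fun i : 'I_n => G i.+1 - D i)) => [|i _].
  2: by apply: HS; rewrite ltnS.
rewrite !sumrB addrA; congr (_ - _).
transitivity (\sum_(i < n.+1) G i); first by rewrite big_ord_recl.
by rewrite big_ord_recr /= Gn addr0.
Qed.

Section DiagonalSums.
Variables (C : fieldType) (z : C) (r : nat).
Hypotheses (r_odd : odd r) (r_gt1 : (1 < r)%N) (z_prim : r.-primitive_root z).

Local Notation E := (uE z r).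
Local Notation F := (uF z r).
Local Notation T := (uTl z r).
Local Notation Fd := (uFd z r).
Implicit Type c : nat -> nat -> C.

Let r_gt0 : (0 < r)%N := ltnW r_gt1.
Let qf_neq0 n : (n < r)%N -> qfact z n != 0 :=
  @qfact_root_neq0 _ _ _ r_odd r_gt1 z_prim n.

Lemma uFd_lt n : (n < r)%N -> Fd n = (qfact z n)^-1 *: F ^+ n.
Proof. by rewrite /uFd => ->. Qed.

Lemma uFd0 : Fd 0 = 1.
Proof. by rewrite uFd_lt // qfact0 invr1 scale1r. Qed.

Lemma uFdM i j : (i + j < r)%N ->
  Fd i * Fd j = (qfact z (i + j) / (qfact z i * qfact z j)) *: Fd (i + j).
Proof.
move=> ij; rewrite !uFd_lt //; try lia.
rewrite -scalerAl -scalerAr !scalerA -exprD invfM mulrAC mulfV ?mul1r //.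
exact: qf_neq0.
Qed.

Lemma uFdM_ge i j : (r <= i + j)%N -> Fd i * Fd j = 0.
Proof.
move=> ij; rewrite /uFd; case: ifP => _; last by rewrite mul0r.
case: ifP => _; last by rewrite mulr0.
rewrite -scalerAl -scalerAr -exprD -(subnKC ij) exprD uF_exp //.
by rewrite mul0r !scaler0.
Qed.

Lemma uEX_ge n : (r <= n)%N -> E ^+ n = 0.
Proof. by move=> rn; rewrite -(subnKC rn) exprD uE_exp // mul0r. Qed.

(** Divided powers absorb the factor [n+1] of [cF], leaving the scalar that appears in
    [E_balanced]. *)
Lemma uE_Fd_uT n m : (n.+1 < r)%N ->
  Fd n.+1 * E * T m =
  E * Fd n.+1 * T m - (z ^- (n + 2 * m) - z ^+ (n + 2 * m)) *: (Fd n * T m).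
Proof.
move=> n_lt; rewrite !uFd_lt ?(ltnW n_lt) // -scalerAr -!scalerAl uE_FX_uT //.
rewrite scalerDr !scalerA /cF qfactS.
have qn0 := qf_neq0 (ltnW n_lt).
have q0 := qint_root_neq0 r_odd r_gt1 z_prim (k := n.+1) n_lt.
rewrite -addrA -scalerBl; move: (z ^- _ - _) => p.
rewrite [X in _ + X *: _](_ : _ = 0) ?scale0r ?addr0 //.
by field; apply/andP.
Qed.

Definition diag_sum c : uz z r :=
  \sum_(m < r) \sum_(i < r) c i m *: (E ^+ i * Fd i * T m).

Definition periodic2 c := forall i m, c i (m %% r)%N = c i m.

Lemma diag_sum_uT c m : periodic2 c ->
  diag_sum c * T m = \sum_(i < r) c i m *: (E ^+ i * Fd i * T m).
Proof.
move=> c_per; rewrite -(uT_mod z_prim m).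
under [RHS]eq_bigr do rewrite -c_per.
have m_lt : (m %% r < r)%N by rewrite ltn_mod.
move: (m %% r)%N m_lt => {}m m_lt.
rewrite mulr_suml (bigD1 (Ordinal m_lt)) //= [X in _ + X]big1 ?addr0.
  rewrite mulr_suml; apply: eq_bigr => i _.
  by rewrite -scalerAl -[_ * T m * _]mulrA uT_orth // eqxx scale1r.
move=> j; rewrite -val_eqE /= => /negbTE jm.
rewrite mulr_suml big1 // => i _.
by rewrite -scalerAl -[_ * T j * _]mulrA uT_orth // jm scale0r mulr0 scaler0.
Qed.

Lemma diag_sum_uE c : periodic2 c -> E_balanced z c ->
  diag_sum c * E = E * diag_sum c.
Proof.
move=> c_per c_bal; apply: (eq_on_uT r_odd r_gt1 z_prim) => m.
rewrite -mulrA -uT_E // mulrA -[RHS]mulrA !diag_sum_uT // mulr_suml mulr_sumr.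
(* G is the term in which E has passed the divided power, D the commutator correction; E^r = 0 kills
   the end terms. *)
pose G i : uz z r := c i m *: (E ^+ i.+1 * Fd i * T m.+1).
pose D i : uz z r := (c i.+1 m * (z ^- (i + 2 * m.+1) - z ^+ (i + 2 * m.+1))) *:
  (E ^+ i.+1 * Fd i * T m.+1).
have Er : E ^+ r.-1.+1 = 0 by rewrite prednK // uE_exp.
apply: (sum_shift (H := fun i => c i m *: (E ^+ i * Fd i * T m) * E)
  (L := fun i => E * (c i m.+1 *: (E ^+ i * Fd i * T m.+1)))
  (G := G) (D := D)) => //.
- by rewrite /G expr0 expr1 uFd0 !mul1r mulr1 -scalerAl uT_E.
- move=> i i_lt; rewrite -scalerAl -[_ * T m * E]mulrA uT_E // mulrA.
  rewrite -[_ * Fd i.+1 * E]mulrA -[_ * _ * T m.+1]mulrA uE_Fd_uT //.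
  rewrite mulrBr scalerBr -scalerAr scalerA.
  by rewrite /G /D !mulrA -!exprSr.
- move=> i i_lt; rewrite -scalerAr c_bal scalerBl.
  by rewrite /G /D !mulrA -!exprS.
- by rewrite /G Er !mul0r scaler0.
- by rewrite -scalerAr !mulrA -exprS Er !mul0r scaler0.
Qed.

Lemma diag_sum_uEX c n : periodic2 c -> E_balanced z c ->
  diag_sum c * E ^+ n = E ^+ n * diag_sum c.
Proof.
move=> c_per c_bal; elim: n => [|n IHn]; first by rewrite expr0 mulr1 mul1r.
by rewrite exprSr mulrA IHn -mulrA diag_sum_uE // mulrA.
Qed.

Lemma diag_sum_left_inverse c c' : periodic2 c -> E_balanced z c ->
  periodic2 c' -> (forall m, c' 0 m * c 0 m = 1) ->
  (forall k m, (0 < k < r)%N -> \sum_(i < k.+1)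
    c' i m * c (k - i)%N (m + i)%N / (qfact z i * qfact z (k - i)) = 0) ->
  diag_sum c * diag_sum c' = 1.
Proof.
move=> c_per c_bal c'_per c0 cS; apply: (eq_on_uT r_odd r_gt1 z_prim) => m.
rewrite mul1r; move: m.+1 => {}m; rewrite -mulrA diag_sum_uT // mulr_sumr.
pose G i j : uz z r := (c' i m * c j (m + i)%N / (qfact z i * qfact z j)) *:
  (qfact z (i + j) *: (E ^+ (i + j) * Fd (i + j) * T m)).
(* After [diag_sum c] has passed E^i it meets F^(i) T_m = T_(m+i) F^(i), whence the shifted index m
   + i. *)
have GE i : c' i m *: (diag_sum c * (E ^+ i * Fd i * T m)) =
    \sum_(j < r) (c' i m * c j (m + i)%N) *:
      (E ^+ (i + j) * (Fd j * Fd i) * T m).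
  rewrite mulrA mulrA diag_sum_uEX // -!mulrA -uT_Fd // [_ * (T _ * _)]mulrA.
  rewrite diag_sum_uT // mulr_suml mulr_sumr scaler_sumr; apply: eq_bigr => k _.
  rewrite -scalerAl -scalerAr scalerA exprD -!mulrA.
  congr (_ *: (_ * (_ * (_ * _)))).
  by rewrite uT_Fd.
(* Pairs with i + j >= r vanish with E^(i+j); the remaining triangle is summed along i + j = k,
   where the hypotheses apply. *)
transitivity (\sum_(i < r) \sum_(j < r - i) G i j).
  apply: eq_bigr => i _; rewrite -scalerAr GE.
  rewrite (big_ord_widen _ (G i) (leq_subr i r)) [RHS]big_mkcond /=.
  apply: eq_bigr => j _; case: ltnP => ij.
    rewrite uFdM; last by lia.
    rewrite /G [(j + i)%N]addnC [qfact z j * _]mulrC.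
    rewrite -scalerAr -scalerAl !scalerA.
    by congr (_ *: _); rewrite mulrA mulrAC.
  by rewrite uEX_ge ?mul0r ?scaler0 //; lia.
rewrite -sum_antidiagonal (bigD1 (Ordinal r_gt0)) //= big_ord1.
rewrite big1 ?addr0 => [|k].
  by rewrite /G addn0 c0 qfact0 expr0 uFd0 !mulr1 divr1 !scale1r mul1r.
rewrite -val_eqE /= -lt0n => k_gt0.
transitivity ((\sum_(i < k.+1) c' i m * c (k - i)%N (m + i)%N /
    (qfact z i * qfact z (k - i))) *: (qfact z k *: (E ^+ k * Fd k * T m))).
  rewrite scaler_suml; apply: eq_bigr => i _.
  by rewrite /G subnKC // -ltnS.
by rewrite cS ?scale0r // k_gt0 ltn_ord.
Qed.

End DiagonalSums.

(** * The ribbon element and its inverse *)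

Section Ribbon.
Variables (C : fieldType) (z : C) (r : nat).
Hypotheses (r_odd : odd r) (r_gt1 : (1 < r)%N) (z_prim : r.-primitive_root z).

Local Notation E := (uE z r).
Local Notation F := (uF z r).
Local Notation K := (uK z r).
Local Notation T := (uTl z r).
Local Notation Fd := (uFd z r).
Implicit Types (x y : uz z r) (c : nat -> nat -> C).

Let r_gt0 : (0 < r)%N := ltnW r_gt1.
Let z_neq0 : z != 0 := root_neq0 r_gt1 z_prim.
Let zX_neq0 n : z ^+ n != 0 := expf_neq0 n z_neq0.
Let zr1 n : z ^+ n ^+ r = 1.
Proof. by rewrite -exprM mulnC exprM (prim_expr_order z_prim) expr1n. Qed.
Let qf_neq0 n : (n < r)%N -> qfact z n != 0 :=
  @qfact_root_neq0 _ _ _ r_odd r_gt1 z_prim n.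
Let Ku : K \is a GRing.unit := uK_unit z r_gt0.

Lemma diag_sum_tw_itw : diag_sum z r (tw z) * diag_sum z r (itw z) = 1.
Proof.
apply: diag_sum_left_inverse => //.
- by move=> i m; apply: tw_mod.
- exact: (tw_balanced r_odd r_gt1 z_prim).
- by move=> i m; apply: itw_mod.
- by move=> m; rewrite /itw expr0 div1r mulVf // (tw_neq0 r_gt1 z_prim).
- by move=> k m k_in; apply: (itw_tw_sum r_odd r_gt1 z_prim).
Qed.

Lemma diag_sum_itw_tw : diag_sum z r (itw z) * diag_sum z r (tw z) = 1.
Proof.
apply: diag_sum_left_inverse => //.
- by move=> i m; apply: itw_mod.
- exact: (itw_balanced r_odd r_gt1 z_prim).
- by move=> i m; apply: tw_mod.
- by move=> m; rewrite /itw expr0 div1r mulfV // (tw_neq0 r_gt1 z_prim).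
- by move=> k m k_in; apply: (tw_itw_sum r_odd r_gt1 z_prim).
Qed.

(** After normal ordering each E^j F^j, put j = k + s; the sum over s is [itw_reorder]. *)
Lemma diag_sum_itw_reorder m : diag_sum z r (itw z) * T m =
  \sum_(k < r) (itw z k m * z ^+ (4 * m * k.+1) / qfact z k) *:
    (F ^+ k * E ^+ k * T m).
Proof.
rewrite diag_sum_uT //; last by move=> i n; apply: itw_mod.
pose G k s := (itw z (k + s) m * cprod z s m * qfact z (k + s) / qfact z s /
  qfact z k ^+ 2) *: (F ^+ k * E ^+ k * T m).
transitivity (\sum_(j < r) \sum_(k < j.+1) G k (j - k)%N).
  apply: eq_bigr => j _; have j_lt := ltn_ord j.
  rewrite uFd_lt // -scalerAr -scalerAl scalerA uEX_FX_uT // scaler_sumr.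
  apply: eq_bigr => -[k /= k_le] _; rewrite scalerA /G subnKC //.
  have qk : qfact z k != 0 by apply: qf_neq0; lia.
  have qjk : qfact z (j - k) != 0 by apply: qf_neq0; lia.
  have qj := qf_neq0 j_lt.
  congr (_ *: _); rewrite /reorder_coef; move: (itw z j m) (cprod _ _ _) => x y.
  by field; do ?[apply/andP; split].
rewrite sum_antidiagonal; apply: eq_bigr => k _.
have qk := qf_neq0 (ltn_ord k).
rewrite -scaler_suml -mulr_suml itw_reorder // -mulrA; congr (_ *: _).
congr (_ * _); rewrite expr2; move: (qfact z k) qk => q q0.
by field.
Qed.

Lemma uK_FX_eigen n x a : K * x = a *: x ->
  K * (F ^+ n * x) = (a / z ^+ (2 * n)) *: (F ^+ n * x).
Proof.
move=> Kx; elim: n => [|n IHn]; first by rewrite expr0 mul1r divr1.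
rewrite exprS -[F * _ * x]mulrA [LHS]mulrA (uKF_comm z r_gt0) -scalerAl.
rewrite -[F * K * _]mulrA IHn.
rewrite -scalerAr scalerA; congr (_ *: _); rewrite mulnS exprD; field.
by rewrite !zX_neq0.
Qed.

(** The successive K act by a z^(-2t) for t = 1, ..., n, and these exponents add up to -n(n+1). *)
Lemma uKFX_eigen n x a : K * x = a *: x ->
  (K * F) ^+ n * x = (a ^+ n / z ^+ (n * n.+1)) *: (F ^+ n * x).
Proof.
move=> Kx; elim: n => [|n IHn]; first by rewrite !expr0 mul1r divr1 scale1r.
rewrite exprS -mulrA IHn -scalerAr -[K * F * _]mulrA [F * (_ * x)]mulrA -exprS.
rewrite (uK_FX_eigen _ Kx) scalerA; congr (_ *: _).
have -> : (n.+1 * n.+2 = n * n.+1 + 2 * n.+1)%N by ring.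
by rewrite [z ^+ (_ + _)]exprD exprSr; field; rewrite !zX_neq0.
Qed.

Lemma uK_invX_eigen n x a : a != 0 -> K * x = a *: x ->
  K ^- n * x = a ^- n *: x.
Proof.
move=> a0 Kx; apply: (mulrI (unitrX n Ku)); rewrite mulVKr ?unitrX // -scalerAr.
suff -> : K ^+ n * x = a ^+ n *: x by rewrite scalerA mulVf ?scale1r ?expf_neq0.
elim: n => [|n IHn]; first by rewrite !expr0 mul1r scale1r.
by rewrite exprSr -mulrA Kx -scalerAr IHn scalerA -exprS.
Qed.

Lemma uS_X x n : uS (x ^+ n) = uS x ^+ n.
Proof. by elim: n => [|n IHn]; rewrite ?expr0 ?uS1 // exprS uSM IHn exprSr. Qed.

(** As S(K) = K^-1, S(T_b) projects onto the eigenvalue z^(2b), the inverse of that of T_b. *)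
Lemma uS_uT_eigen b x a : a != 0 -> a ^+ r = 1 -> K * x = a *: x ->
  uS (uT z r b) * x = (z ^+ (2 * b) / a == 1)%:R *: x.
Proof.
move=> a0 ar Kx; rewrite -(geometric_mean z_prim); last first.
  by rewrite exprMn exprVn zr1 ar invr1 mulr1.
rewrite /uT linearZ linear_sum /= -scalerAl mulr_suml -scalerA scaler_suml.
congr (_ *: _); apply: eq_bigr => c _; rewrite linearZ /= uS_X uS_K //.
by rewrite exprVn -scalerAl (uK_invX_eigen _ a0 Kx) scalerA exprMn exprVn exprM.
Qed.

Lemma uS_Fd a : (a < r)%N ->
  uS (Fd a) = ((-1) ^+ a / qfact z a) *: (K * F) ^+ a.
Proof.
move=> a_lt; rewrite uFd_lt // linearZ /= uS_X uS_F -scaleN1r exprZn scalerA.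
by rewrite mulrC.
Qed.

(** Each summand of u acts on T_m as S(F^(a)) S(T_b) K^-b E^a. Since E^a T_m is a K-eigenvector,
    S(T_b) selects one b and the powers of K become scalars. *)
Lemma ribbon_uT m : ribbon z r * T m =
  \sum_(k < r) (itw z k m * z ^+ (4 * m * k.+1) / qfact z k) *:
    (F ^+ k * E ^+ k * T m).
Proof.
have KVT : K^-1 * T m = z ^+ (2 * m) *: T m.
  have := uK_invX_eigen 1 (invr_neq0 (zX_neq0 (2 * m))) (uK_uT r_gt1 z_prim m).
  by rewrite !expr1 invrK.
rewrite /ribbon -mulrA KVT -scalerAr /drinfeld_u mulr_suml scaler_sumr.
apply: eq_bigr => -[a /= a_lt] _; rewrite mulr_suml.
pose x : uz z r := E ^+ a * T m; pose lam := z ^+ (2 * a) / z ^+ (2 * m).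
have lam0 : lam != 0 by rewrite mulf_neq0 ?invr_neq0.
have lamr : lam ^+ r = 1 by rewrite exprMn exprVn !zr1 invr1 mulr1.
have Kx : K * x = lam *: x by rewrite /x uK_EX_uT.
(* The representative of a - m modulo r, the one b < r for which z^(2b) is the eigenvalue [lam]. *)
pose b0 := ((a + m * r.-1) %% r)%N.
have b0_lt : (b0 < r)%N by rewrite ltn_mod.
have zb0 : z ^+ b0 = z ^+ a / z ^+ m.
  apply: (canRL (mulfK (zX_neq0 _))); rewrite (prim_expr_mod z_prim) -exprD.
  rewrite -addnA -mulnSr prednK // mulnC exprD exprM.
  by rewrite (prim_expr_order z_prim) expr1n mulr1.
have lamE : lam = z ^+ (2 * b0).
  by rewrite /lam !(mulnC 2%N) !exprM zb0 expr_div_n.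
have lam_b0 :
    lam ^+ b0 = z ^+ (2 * a * a) * z ^+ (2 * m * m) / z ^+ (4 * m * a).
  rewrite /lam expr_div_n -!exprM ![(2 * _ * b0)%N]mulnC !(exprM z b0) zb0.
  rewrite !expr_div_n -!exprM.
  have -> : (4 * m * a = m * (2 * a) + a * (2 * m))%N by ring.
  have [-> ->] : (2 * a * a = a * (2 * a) /\ 2 * m * m = m * (2 * m))%N.
    by split; ring.
  rewrite exprD; have := zX_neq0 (m * (2 * a)); have := zX_neq0 (a * (2 * m)).
  have := zX_neq0 (m * (2 * m)).
  move: (z ^+ _) (z ^+ _) (z ^+ (m * (2 * a))) (z ^+ (a * (2 * m))).
  move=> x1 x2 x3 x4.
  by move=> ? ? ?; field; do ?[apply/andP; split].
have termE b : (b < r)%N -> uS (Rsnd z r a b) * Rfst z r a b * T m =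
    ((b == b0)%:R * lam ^- b) *: (z ^+ (a * (a - 1))./2 *: (uS (Fd a) * x)).
  move=> b_lt; rewrite /Rsnd /Rfst uSM -scalerAr -scalerAl -!mulrA -/x.
  rewrite (uK_invX_eigen _ lam0 Kx) -[_ * (lam ^- b *: _)]scalerAr.
  rewrite (uS_uT_eigen _ lam0 lamr Kx) [lam ^- b *: (_ *: _)]scalerA.
  rewrite -[uS (Fd a) * (_ *: _)]scalerAr !scalerA.
  congr (_ *: _); rewrite mulrC [lam ^- b * _]mulrC; congr (_ / _ * _).
  congr (_%:R); congr nat_of_bool.
  rewrite (can2_eq (mulfVK lam0) (mulfK lam0)) mul1r lamE.
  by apply/eqP/eqP => [/(z2_inj r_odd z_prim)->|->].
rewrite (eq_bigr _ (fun (b : 'I_r) _ => termE b (ltn_ord b))).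
rewrite (bigD1 (Ordinal b0_lt)) //= eqxx mul1r big1 ?addr0; last first.
  by move=> b; rewrite -val_eqE /= => /negbTE ->; rewrite mul0r scale0r.
rewrite uS_Fd // -scalerAl (uKFX_eigen _ Kx) lam_b0 !scalerA /x.
congr (_ *: _); last by rewrite mulrA.
have qa := qf_neq0 a_lt.
have lam_a : lam ^+ a = z ^+ (2 * a * a) / z ^+ (2 * m * a).
  by rewrite /lam expr_div_n -!exprM.
rewrite lam_a /itw.
have tw0 := tw_neq0 r_gt1 z_prim a m.
(* Negative powers are moved across, so that only exponents in nat are compared. *)
have expE : z ^+ (2 * m) * z ^+ (4 * m * a) * z ^+ (a * (a - 1))./2 * tw z a m =
   z ^+ (4 * m * a.+1) * z ^+ (2 * m * a) * z ^+ (a * a.+1) * z ^+ (2 * m * m).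
  rewrite /tw -!exprD; congr (z ^+ _).
  by have := half_pred a; have := half_add3 a; case: (a) => [|n]; nia.
have -> : z ^+ (a * (a - 1))./2 =
   z ^+ (4 * m * a.+1) * z ^+ (2 * m * a) * z ^+ (a * a.+1) * z ^+ (2 * m * m)
   / (z ^+ (2 * m) * z ^+ (4 * m * a) * tw z a m).
  apply: (canRL (mulfK _)); first by rewrite !mulf_neq0.
  by rewrite -expE; ring.
have := zX_neq0 (2 * m); have := zX_neq0 (4 * m * a).
have := zX_neq0 (4 * m * a.+1); have := zX_neq0 (2 * m * a).
have := zX_neq0 (a * a.+1); have := zX_neq0 (2 * m * m).
have := zX_neq0 (2 * a * a).
move: (z ^+ (2 * m)) (z ^+ (4 * m * a)) (z ^+ (4 * m * a.+1)) => x1 x2 x3.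
move: (z ^+ (2 * m * a)) (z ^+ (a * a.+1)) (z ^+ (2 * m * m)) => x4 x5 x6.
move: (z ^+ (2 * a * a)) => x7.
by move=> ? ? ? ? ? ? ?; field; do ?[apply/andP; split].
Qed.

Lemma ribbonE : ribbon z r = diag_sum z r (itw z).
Proof.
apply: (eq_on_uT r_odd r_gt1 z_prim) => m.
by rewrite ribbon_uT diag_sum_itw_reorder.
Qed.

Lemma ribbonV : (ribbon z r)^-1 = diag_sum z r (tw z).
Proof.
(* The inverse of a non-unit is by convention the element itself, so invertibility comes first. *)
have u : ribbon z r \is a GRing.unit.
  apply/unitrP; exists (diag_sum z r (tw z)).
  by rewrite ribbonE diag_sum_tw_itw diag_sum_itw_tw.
by apply: (mulrI u); rewrite divrr // ribbonE diag_sum_itw_tw.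
Qed.

Lemma rho1_tau_alphaE l m n : (n < r)%N ->
  rho1_tau_alpha (E ^+ l * uT z r m * Fd n) =
  \sum_(i < r) (qbinom_at z (n + i) n * tw z i m) *:
     (E ^+ (l + i) * uT z r (m + i) * Fd (n + i)).
Proof.
have -> : uT z r = T by rewrite uTl.unlock.
move=> n_lt; rewrite /rho1_tau_alpha ribbonV.
rewrite !mulrA (diag_sum_uEX r_odd r_gt1 z_prim); first last.
- exact: (tw_balanced r_odd r_gt1 z_prim).
- by move=> i k; apply: tw_mod.
rewrite -[E ^+ l * _ * T m]mulrA (diag_sum_uT r_odd r_gt1 z_prim); last first.
  by move=> i k; apply: tw_mod.
rewrite mulr_sumr mulr_suml; apply: eq_bigr => i _.
have i_lt := ltn_ord i.
rewrite -scalerAr -scalerAl -[_ * Fd i * T m]mulrA -uT_Fd //.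
have -> : E ^+ l * (E ^+ i * (T (m + i) * Fd i)) * Fd n =
    E ^+ (l + i) * T (m + i) * (Fd i * Fd n) by rewrite exprD !mulrA.
(* For n + i >= r both sides vanish, by the convention F^(a) = 0 for a >= r; otherwise the
   factorials up to n + i are nonzero and the binomial is their quotient. *)
have [ni_ge|ni_lt] := leqP r (i + n).
  have ni_nlt : (n + i < r)%N = false by lia.
  by rewrite uFdM_ge // /uFd ni_nlt !mulr0 !scaler0.
rewrite uFdM // -[_ * _ * (_ *: _)]scalerAr scalerA [(i + n)%N]addnC.
congr (_ *: _); rewrite [LHS]mulrC (qbinom_atE z_neq0) => [|k k_in].
  by rewrite [qfact z i * _]mulrC.
by apply: (qint_root_neq0 r_odd r_gt1 z_prim); lia.
Qed.

End Ribbon.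

Theorem lemma5p3 (R : realType) (r : nat) (r_ge3 : (3 <= r)%N) (r_odd : odd r)
    (l m n : nat) (l_lt_r : (l < r)%N) (m_lt_r : (m < r)%N) (n_lt_r : (n < r)%N) :
  let z : R[i] := zeta R r in
  rho1_tau_alpha (uE z r ^+ l * uT z r m * uFd z r n) =
  z ^+ (2 * (m + 1) * m) *:
    \sum_(i < r) (qbinom_at z (n + i) n * z ^+ (((i + 3) * i)./2 + 2 * m * i)) *:
      (uE z r ^+ (l + i) * uT z r (m + i) * uFd z r (n + i)).
Proof.
move=> z; have r_gt1 : (1 < r)%N by exact: ltnW.
have z_prim := zeta_primitive R (ltnW r_gt1).
rewrite (rho1_tau_alphaE r_odd r_gt1 z_prim) // scaler_sumr.
by apply: eq_bigr => i _; rewrite scalerA /tw mulrCA.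
Qed.
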